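(* The analytic unimodal map $f_*^\omega$ is not a hyperbolic fixed point of the period doubling renormalization operator $R:\mathcal U_0^2\to\mathcal U^2$.
   Context: A unimodal map $f:[0,1]\to[0,1]$ is a $C^1$ map with $f(1)=0$, with a unique point $c\in(0,1)$ (the critical point) where $Df(c)=0$, and with $f(c)=1$. It is a $C^r$ unimodal map if $f$ is $C^r$. The critical point $c$ is a quadratic tip if there exist a sequence $x_n\to c$ (with $x_n\neq c$) and a constant $A>0$ such that $\lim_{n\to\infty}\frac{f(x_n)-f(c)}{(x_n-c)^2}=-A$. The set of $C^r$ unimodal maps with a quadratic tip is denoted $\mathcal U^r$. A unimodal map $f$ with quadratic tip $c$ is renormalizable if (1) $c\in[f^2(c),f^4(c)]=:I_0^1$, (2) $f(I_0^1)=[f^3(c),f(c)]=:I_1^1$, (3) $I_0^1\cap I_1^1=\emptyset$. The set of renormalizable maps in $\mathcal U^r$ is $\mathcal U_0^r$. The renormalization operator is $R:\mathcal U_0^r\to\mathcal U^r$, $Rf=h^{-1}\circ f^2\circ h$, where $h:[0,1]\to I_0^1$ is the orientation reversing affine homeomorphism. $\mathrm{dist}_k$ is the $C^k$ distance. $f_*^\omega$ denotes the analytic renormalization fixed point: by a known theorem of Davie, for $\alpha<1$ close enough to $1$ there is a unique $f_*^\omega\in\mathcal U^{2+\alpha}$ (maps whose second derivative is $\alpha$-Hölder) with $Rf_*^\omega=f_*^\omega$, and it is analytic. Hyperbolicity: the part of hyperbolicity at issue is the exponential attraction in the stable manifold. If $f_*^\omega$ is a hyperbolic fixed point of $R:\mathcal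 U_0^2\to\mathcal U^2$, then there is $\lambda<1$ such that every $f\in\mathcal U^2$ for which all $R^nf$ are defined and $\mathrm{dist}_2(R^nf,f_*^\omega)\to0$ satisfies $\mathrm{dist}_0(R^nf,f_*^\omega)\le C_f\lambda^n$ for all $n$, for some constant $C_f$. ''Not hyperbolic'' means that this property fails. *)

(* Defs.v *)
From Stdlib Require Export Reals.
From Coquelicot Require Export Coquelicot.
Open Scope R_scope.

(** A map [0,1] -> [0,1] is represented by a function R -> R of which only the
    restriction to [0,1] matters: derivatives and limits below are taken within
    [0,1] (so they are one-sided at 0 and 1), and maps are compared on [0,1]. *)

Definition I01 (x : R) : Prop := 0 <= x <= 1.

Definition eq01 (f g : R -> R) : Prop := forall x, I01 x -> f x = g x.

(** [iota] is definite description; the value is meaningful at the points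
    where the limit exists, which is what [D_in f (deriv f) I01 x] asserts. *)
Definition deriv (f : R -> R) (x : R) : R :=
  iota (fun l => limit1_in (fun y => (f y - f x) / (y - x)) (D_x I01 x) l x).

Definition deriv_n (k : nat) (f : R -> R) : R -> R := Nat.iter k deriv f.

Definition C_k (k : nat) (f : R -> R) : Prop :=
  (forall j x, (j < k)%nat -> I01 x ->
     D_in (deriv_n j f) (deriv_n (S j) f) I01 x) /\
  (forall x, I01 x -> continue_in (deriv_n k f) I01 x).

(** C^k distance on [0,1]: the maximum over j <= k of the sup norms of the
    differences of the j-th derivatives.  For C^k maps the set is bounded (and
    nonempty), so that [real] loses nothing. *)
Definition dist (k : nat) (f g : R -> R) : R :=
  real (Lub_Rbar (fun d => exists j x, (j <= k)%nat /\ I01 x /\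
                           d = Rabs (deriv_n j f x - deriv_n j g x))).

Definition critical (f : R -> R) (c : R) : Prop := 0 < c < 1 /\ deriv f c = 0.

Definition crit (f : R -> R) : R := iota (critical f).

Definition unimodal (f : R -> R) : Prop :=
  (forall x, I01 x -> I01 (f x)) /\ C_k 1 f /\ f 1 = 0 /\
  (exists! c, critical f c) /\ f (crit f) = 1.

Definition quadratic_tip (f : R -> R) : Prop :=
  exists (x : nat -> R) (A : R),
    (forall n, I01 (x n) /\ x n <> crit f) /\
    is_lim_seq x (crit f) /\
    0 < A /\
    is_lim_seq (fun n => (f (x n) - f (crit f)) / (x n - crit f) ^ 2) (- A).

Definition U (r : nat) (f : R -> R) : Prop :=
  unimodal f /\ C_k r f /\ quadratic_tip f.

Definition U_2plus (alpha : R) (f : R -> R) : Prop :=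
  U 2 f /\
  exists K, forall x y, I01 x -> I01 y -> x <> y ->
    Rabs (deriv_n 2 f x - deriv_n 2 f y) <= K * Rpower (Rabs (x - y)) alpha.

(** [orb f k] is f^k(c). *)
Definition orb (f : R -> R) (k : nat) : R := Nat.iter k f (crit f).

Definition I_0_1 (f : R -> R) (x : R) : Prop := orb f 2 <= x <= orb f 4.
Definition I_1_1 (f : R -> R) (x : R) : Prop := orb f 3 <= x <= orb f 1.

Definition renormalizable (f : R -> R) : Prop :=
  I_0_1 f (crit f) /\
  (forall y, (exists x, I_0_1 f x /\ f x = y) <-> I_1_1 f y) /\
  (forall x, ~ (I_0_1 f x /\ I_1_1 f x)).

(** The affine map with h(0) = f^4(c) and h(1) = f^2(c), and its inverse. *)
Definition h (f : R -> R) (t : R) : R := orb f 4 + t * (orb f 2 - orb f 4).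
Definition h_inv (f : R -> R) (y : R) : R :=
  (y - orb f 4) / (orb f 2 - orb f 4).

Definition renorm (f : R -> R) : R -> R := fun t => h_inv f (f (f (h f t))).

Definition renorm_n (n : nat) (f : R -> R) : R -> R := Nat.iter n renorm f.

(** All R^n f are defined, as maps in U^2: each R^n f lies in the domain U_0^2
    of the operator. *)
Definition infinitely_renormalizable (f : R -> R) : Prop :=
  forall n, U 2 (renorm_n n f) /\ renormalizable (renorm_n n f).

Definition analytic01 (f : R -> R) : Prop :=
  forall x0, I01 x0 -> exists (a : nat -> R) (r : R), 0 < r /\
    forall x, I01 x -> Rabs (x - x0) < r -> is_pseries a (x - x0) (f x).

Definition fixed_point_2plus (alpha : R) (f : R -> R) : Prop :=
  U_2plus alpha f /\ renormalizable f /\ eq01 (renorm f) f.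

(** Davie's theorem: such a map exists, and it is unique on [0,1]. *)
Definition is_analytic_fixed_point (f : R -> R) : Prop :=
  analytic01 f /\
  exists alpha0, 0 < alpha0 < 1 /\
    forall alpha, alpha0 < alpha < 1 ->
      fixed_point_2plus alpha f /\
      forall g, fixed_point_2plus alpha g -> eq01 g f.

(** Hyperbolicity of a fixed point of R : U_0^2 -> U^2, in the sense of uniform
    exponential attraction (rate independent of the map) in the stable set. *)
Definition hyperbolic (fstar : R -> R) : Prop :=
  exists lambda, lambda < 1 /\
    forall f, U 2 f -> infinitely_renormalizable f ->
      is_lim_seq (fun n => dist 2 (renorm_n n f) fstar) 0 ->
      exists C, forall n, dist 0 (renorm_n n f) fstar <= C * lambda ^ n.

(* Main.v *)
(* The renormalization of [F = fstar] reads [F (F (h t)) = h (F t)] with [h] affine,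
   [h c = c].  Insert a small diffeomorphism [psi_t] into [F] on an interval [(a, b)] on
   the left of [c], and the map that undoes its effect one iterate later on
   [(F a, F b)]; then [F^2] is unchanged on [(a, b)].  Copying this displacement by
   all powers of [h], with size [T k] at level [k], gives maps [pert T = F o X_T]
   such that renormalization shifts the sequence: [R (pert T) = pert (T o S)].  As
   [F' = O(x - c)], the perturbation stays bounded in [C^2] under the rescalings, so
   [pert T] is [C^2] as soon as [T k -> 0], while the distance of [R^n (pert T)] to
   [F] is at least a constant times [T n], which may tend to [0] as slowly as desired. *)

Require Import Defs.
From Stdlib Require Import Lra Lia PSeries_reg Ranalysis5 ClassicalEpsilon.

(** * Twice differentiable functions on the line *)

(** The gap [(s, p)] between [I_0^1] and [I_1^1] makes room for the construction. The first window
    is the [h]-image of a piece of the gap and the second lies in [I_1^1], while all copies of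
    positive level lie in [[0, s]]; pulling back by [h] then shows that no two copies meet. So the
    perturbation is a sum with disjoint supports, for which uniform smallness of the terms replaces
    summability: this is why no rate has to be imposed on [T]. A Hoelder condition of exponent
    [alpha] on the second derivative would still see the scale, costing a factor [s ^ (- k alpha)]
    at level [k] and forcing exponential decay of [T]; the slow convergence is thus a [C^2]
    phenomenon. Since hyperbolicity fixes [lambda] before the map, a geometric [T] with ratio
    strictly between [lambda] and [1] is already slow enough. *)

Definition C2_at (f f1 f2 : R -> R) (x : R) : Prop :=
  is_derive f x (f1 x) /\ is_derive f1 x (f2 x) /\ continuity_pt f2 x.

Lemma is_derive_continuity_pt (f : R -> R) (x l : R) :
  is_derive f x l -> continuity_pt f x.
Proof.
  intros H. apply continuity_pt_filterlim, (ex_derive_continuous f). now exists l.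
Qed.

Lemma C2_at_continuity (f f1 f2 : R -> R) (x : R) :
  C2_at f f1 f2 x -> continuity_pt f x /\ continuity_pt f1 x /\ continuity_pt f2 x.
Proof. intros (H0 & H1 & H2). eauto using is_derive_continuity_pt. Qed.

(** Derivatives are carried as explicit functions, so this serves both to exchange derivative
    formulas and to treat piecewise definitions chart by chart. *)
Lemma C2_at_ext_loc (f f1 f2 g g1 g2 : R -> R) (x : R) :
  locally x (fun y => f y = g y /\ f1 y = g1 y /\ f2 y = g2 y) ->
  C2_at f f1 f2 x -> C2_at g g1 g2 x.
Proof.
  intros Hloc (H0 & H1 & H2).
  destruct (locally_singleton _ _ Hloc) as (_ & E1 & E2).
  split; [|split].
  - rewrite <- E1. apply (is_derive_ext_loc f); auto.
    revert Hloc. apply filter_imp. tauto.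
  - rewrite <- E2. apply (is_derive_ext_loc f1); auto.
    revert Hloc. apply filter_imp. tauto.
  - apply (continuity_pt_ext_loc f2); auto.
    revert Hloc. apply filter_imp. tauto.
Qed.

Lemma C2_at_affine (a b x : R) :
  C2_at (fun y => a * y + b) (fun _ => a) (fun _ => 0) x.
Proof.
  split; [|split].
  - auto_derive; auto; ring.
  - auto_derive; auto; ring.
  - apply continuity_pt_const. now intros u v.
Qed.

Lemma C2_at_id (x : R) : C2_at (fun y => y) (fun _ => 1) (fun _ => 0) x.
Proof.
  apply (C2_at_ext_loc (fun y => 1 * y + 0) (fun _ => 1) (fun _ => 0)).
  - apply filter_forall. intros y. repeat split; ring.
  - apply C2_at_affine.
Qed.

Lemma C2_at_plus (f f1 f2 g g1 g2 : R -> R) (x : R) :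
  C2_at f f1 f2 x -> C2_at g g1 g2 x ->
  C2_at (fun y => f y + g y) (fun y => f1 y + g1 y) (fun y => f2 y + g2 y) x.
Proof.
  intros (A0 & A1 & A2) (B0 & B1 & B2). split; [|split].
  - now apply @is_derive_plus.
  - now apply @is_derive_plus.
  - now apply continuity_pt_plus.
Qed.

Lemma C2_at_scal (a : R) (f f1 f2 : R -> R) (x : R) :
  C2_at f f1 f2 x ->
  C2_at (fun y => a * f y) (fun y => a * f1 y) (fun y => a * f2 y) x.
Proof.
  intros (A0 & A1 & A2). split; [|split].
  - now apply is_derive_scal.
  - now apply is_derive_scal.
  - now apply continuity_pt_scal.
Qed.

Lemma C2_at_minus (f f1 f2 g g1 g2 : R -> R) (x : R) :
  C2_at f f1 f2 x -> C2_at g g1 g2 x ->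
  C2_at (fun y => f y - g y) (fun y => f1 y - g1 y) (fun y => f2 y - g2 y) x.
Proof.
  intros (A0 & A1 & A2) (B0 & B1 & B2). split; [|split].
  - now apply @is_derive_minus.
  - now apply @is_derive_minus.
  - now apply continuity_pt_minus.
Qed.

Lemma C2_at_comp (f f1 f2 g g1 g2 : R -> R) (x : R) :
  C2_at f f1 f2 (g x) -> C2_at g g1 g2 x ->
  C2_at (fun y => f (g y)) (fun y => f1 (g y) * g1 y)
    (fun y => f2 (g y) * g1 y ^ 2 + f1 (g y) * g2 y) x.
Proof.
  intros (A0 & A1 & A2) (B0 & B1 & B2).
  assert (D1 : is_derive (fun y => f1 (g y)) x (f2 (g x) * g1 x)).
  { rewrite Rmult_comm. now apply (is_derive_comp f1 g). }
  assert (Cg := is_derive_continuity_pt _ _ _ B0).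
  assert (Cg1 := is_derive_continuity_pt _ _ _ B1).
  split; [|split].
  - rewrite Rmult_comm. now apply (is_derive_comp f g).
  - replace (f2 (g x) * g1 x ^ 2 + f1 (g x) * g2 x)
      with (f2 (g x) * g1 x * g1 x + f1 (g x) * g2 x) by ring.
    apply (is_derive_mult (fun y => f1 (g y)) g1); auto.
    intros; apply Rmult_comm.
  - apply continuity_pt_plus; apply continuity_pt_mult; auto.
    + now apply (continuity_pt_comp g f2).
    + apply (continuity_pt_comp g1 (fun z => z ^ 2)); auto.
      apply derivable_continuous_pt, derivable_pt_pow.
    + eapply is_derive_continuity_pt, D1.
Qed.

(** * Mean value estimates and compactness *)

Lemma MVT_is_derive (f df : R -> R) (a b : R) :
  a < b -> (forall x, a <= x <= b -> is_derive f x (df x)) ->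
  exists z, a < z < b /\ f b - f a = df z * (b - a).
Proof.
  intros Hab H. destruct (MVT_cor2 f df a b Hab) as (z & E & Hz).
  - intros x Hx. now apply is_derive_Reals, H.
  - eauto.
Qed.

Lemma derive_pos_increasing (f df : R -> R) (a b : R) :
  a < b -> (forall x, a <= x <= b -> is_derive f x (df x)) ->
  (forall x, a < x < b -> 0 < df x) -> f a < f b.
Proof.
  intros Hab Hd Hpos. destruct (MVT_is_derive f df a b Hab Hd) as (z & Hz & E).
  specialize (Hpos z Hz). nra.
Qed.

Lemma derive_neg_decreasing (f df : R -> R) (a b : R) :
  a < b -> (forall x, a <= x <= b -> is_derive f x (df x)) ->
  (forall x, a < x < b -> df x < 0) -> f b < f a.
Proof.
  intros Hab Hd Hneg. destruct (MVT_is_derive f df a b Hab Hd) as (z & Hz & E).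
  specialize (Hneg z Hz). nra.
Qed.

Lemma derive_bounded_lipschitz (f df : R -> R) (M a b : R) :
  (forall z, Rmin a b <= z <= Rmax a b -> is_derive f z (df z)) ->
  (forall z, Rmin a b <= z <= Rmax a b -> Rabs (df z) <= M) ->
  Rabs (f b - f a) <= M * Rabs (b - a).
Proof.
  intros Hd HM.
  destruct (MVT_gen f a b df) as (z & Hz & ->).
  - intros x Hx. apply Hd. lra.
  - intros x Hx. eapply is_derive_continuity_pt, Hd, Hx.
  - rewrite Rabs_mult. apply Rmult_le_compat_r; auto using Rabs_pos.
Qed.

Lemma continuous_bounded (f : R -> R) (a b : R) :
  (forall x, a <= x <= b -> continuity_pt f x) ->
  exists M, 0 < M /\ forall x, a <= x <= b -> Rabs (f x) <= M.
Proof.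
  intros Hc. destruct (Rle_dec a b) as [Hab|Hab].
  - destruct (continuity_ab_maj (fun x => Rabs (f x)) a b Hab) as (z & Hz & _).
    + intros x Hx. apply (continuity_pt_comp f Rabs); auto. apply Rcontinuity_abs.
    + exists (Rabs (f z) + 1). split; [pose proof (Rabs_pos (f z)); lra|].
      intros x Hx. specialize (Hz x Hx). simpl in Hz. lra.
  - exists 1. split; [lra|]. intros; lra.
Qed.

Lemma continuous_pos_below (f : R -> R) (a b : R) :
  (forall x, a <= x <= b -> continuity_pt f x /\ 0 < f x) ->
  exists m, 0 < m /\ forall x, a <= x <= b -> m <= f x.
Proof.
  intros Hc. destruct (Rle_dec a b) as [Hab|Hab].
  - destruct (continuity_ab_min f a b Hab) as (z & Hz & Iz).
    + intros x Hx. now apply Hc.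
    + exists (f z). split; auto. now apply Hc.
  - exists 1. split; [lra|]. intros; lra.
Qed.

Lemma uniform_continuity_1d (f : R -> R) (a b : R) :
  (forall x, a <= x <= b -> continuity_pt f x) ->
  forall eps, 0 < eps -> exists delta, 0 < delta /\
    forall x y, a <= x <= b -> a <= y <= b -> Rabs (y - x) < delta ->
      Rabs (f y - f x) < eps.
Proof.
  intros Hc eps He.
  (* The second variable is a dummy on the degenerate interval [[0, 0]]. *)
  destruct (uniform_continuity_2d (fun x _ => f x) a b 0 0) with (eps := mkposreal eps He)
    as (d & Hd).
  - intros x y Hx Hy. apply (continuity_1d_2d_pt_comp f (fun u _ => u)).
    + now apply Hc.
    + apply continuity_2d_pt_id1.
  - exists d. split; [apply cond_pos|]. intros x y Hx Hy Hxy.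
    apply (Hd x 0 y 0); auto; try lra.
    rewrite Rminus_0_r, Rabs_R0. apply cond_pos.
Qed.

(** Joint continuity on a compact rectangle turns vanishing on the edge [t = 0] into uniform
    smallness near it; this is how [disp_small] gets one [tau] for a whole window. *)
Lemma uniform_limit_at_0 (Q : R -> R -> R) (T a b : R) :
  0 < T ->
  (forall t z, 0 <= t <= T -> a <= z <= b -> continuity_2d_pt Q t z) ->
  (forall z, a <= z <= b -> Q 0 z = 0) ->
  forall eps, 0 < eps -> exists tau, 0 < tau /\
    forall t z, 0 <= t <= T -> t <= tau -> a <= z <= b -> Rabs (Q t z) <= eps.
Proof.
  intros HT Hc H0 eps He.
  destruct (uniform_continuity_2d Q 0 T a b Hc (mkposreal eps He)) as (d & Hd).
  exists (d / 2). pose proof (cond_pos d). split; [lra|].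
  intros t z Ht Ht' Hz.
  assert (B : Rabs (Q t z - Q 0 z) < eps).
  { apply (Hd 0 z t z); auto; try lra.
    - rewrite Rminus_0_r, Rabs_pos_eq; lra.
    - rewrite Rminus_diag, Rabs_R0. lra. }
  rewrite (H0 z Hz), Rminus_0_r in B. lra.
Qed.

(** * Series of functions with disjoint supports *)

Lemma disjoint_sum_single (a : nat -> R) (j n : nat) :
  (forall k, k <> j -> a k = 0) -> (j <= n)%nat -> sum_f_R0 a n = a j.
Proof.
  intros H. induction n as [|n IH]; intros Hn; simpl.
  - now replace j with 0%nat by lia.
  - destruct (Nat.eq_dec j (S n)) as [->|Hj].
    + rewrite sum_eq_R0; [lra|]. intros k Hk. apply H. lia.
    + rewrite IH by lia. rewrite (H (S n)) by auto. lra.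
Qed.

Lemma disjoint_sum_none (a : nat -> R) (j n : nat) :
  (forall k, k <> j -> a k = 0) -> (n < j)%nat -> sum_f_R0 a n = 0.
Proof. intros H Hn. apply sum_eq_R0. intros k Hk. apply H. lia. Qed.

(** The error of the [n]-th partial sum at [y] is either zero or the single term of index [j y > n],
    so no tail has to be summed. *)
Lemma disjoint_sum_CVU (a : nat -> R -> R) (j : R -> nat) (x : R) (r : posreal) :
  (forall y k, k <> j y -> a k y = 0) ->
  (forall eps, 0 < eps -> exists N, forall k y, (N <= k)%nat -> Rabs (a k y) <= eps) ->
  CVU (fun n y => sum_f_R0 (fun k => a k y) n) (fun y => a (j y) y) x r.
Proof.
  intros Hj Hu eps He. destruct (Hu (eps / 2)) as (N & HN); [lra|].
  exists N. intros n y Hn _.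
  destruct (Nat.le_gt_cases (j y) n) as [Hl|Hl].
  - rewrite (disjoint_sum_single _ (j y)) by auto.
    rewrite Rminus_diag, Rabs_R0. auto.
  - rewrite (disjoint_sum_none _ (j y)) by auto.
    rewrite Rminus_0_r. assert (Rabs (a (j y) y) <= eps / 2) by (apply HN; lia). lra.
Qed.

(* Disjointness of the supports makes the partial sums converge uniformly as
   soon as the terms tend to [0] uniformly, without any summability. *)
Lemma disjoint_sum_C2 (a a1 a2 : nat -> R -> R) (j : R -> nat) :
  (forall k x, C2_at (a k) (a1 k) (a2 k) x) ->
  (forall x k, k <> j x -> a k x = 0 /\ a1 k x = 0 /\ a2 k x = 0) ->
  (forall eps, 0 < eps -> exists N, forall k x, (N <= k)%nat ->
     Rabs (a k x) <= eps /\ Rabs (a1 k x) <= eps /\ Rabs (a2 k x) <= eps) ->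
  forall x, C2_at (fun y => a (j y) y) (fun y => a1 (j y) y) (fun y => a2 (j y) y) x.
Proof.
  intros HC Hj Hu x.
  assert (Hj' : forall y k, k <> j y -> a k y = 0) by (intros; now apply Hj).
  assert (Hj1 : forall y k, k <> j y -> a1 k y = 0) by (intros; now apply Hj).
  assert (Hj2 : forall y k, k <> j y -> a2 k y = 0) by (intros; now apply Hj).
  assert (U1 : forall eps, 0 < eps -> exists N, forall k y, (N <= k)%nat -> Rabs (a1 k y) <= eps).
  { intros e He. destruct (Hu e He) as (N & HN). exists N. intros. now apply HN. }
  assert (U2 : forall eps, 0 < eps -> exists N, forall k y, (N <= k)%nat -> Rabs (a2 k y) <= eps).
  { intros e He. destruct (Hu e He) as (N & HN). exists N. intros. now apply HN. }
  (* The convergence theorems are stated on a ball; here convergence is uniform on the whole line,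
     so the radius is arbitrary. *)
  set (one := mkposreal 1 Rlt_0_1).
  assert (Bx : forall y, Boule y one y).
  { intros y. unfold Boule. rewrite Rminus_diag, Rabs_R0. apply cond_pos. }
  assert (Lim : forall (g : nat -> R -> R), (forall y k, k <> j y -> g k y = 0) ->
    forall y, Un_cv (fun n => sum_f_R0 (fun k => g k y) n) (g (j y) y)).
  { intros g Hg y e He. exists (j y). intros n Hn.
    rewrite (disjoint_sum_single _ (j y)) by (auto; lia).
    unfold Rdist. rewrite Rminus_diag, Rabs_R0. auto. }
  assert (Dsum : forall (g g1 : nat -> R -> R), (forall k y, is_derive (g k) y (g1 k y)) ->
    forall n y, is_derive (fun z => sum_f_R0 (fun k => g k z) n) y (sum_f_R0 (fun k => g1 k y) n)).
  { intros g g1 Hg n y. induction n as [|n IH]; simpl; auto.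
    apply @is_derive_plus; auto. }
  assert (C1 : forall y, continuity_pt (fun z => a1 (j z) z) y).
  { intros y. apply (CVU_continuity _ _ y one (disjoint_sum_CVU a1 j y one Hj1 U1)); auto.
    intros n z _. eapply is_derive_continuity_pt, Dsum. intros k w. apply HC. }
  assert (C2 : forall y, continuity_pt (fun z => a2 (j z) z) y).
  { intros y. apply (CVU_continuity _ _ y one (disjoint_sum_CVU a2 j y one Hj2 U2)); auto.
    intros n z _. induction n as [|n IH]; simpl.
    - apply HC.
    - apply continuity_pt_plus; auto. apply HC. }
  split; [|split; auto]; apply is_derive_Reals.
  - apply (derivable_pt_lim_CVU (fun n y => sum_f_R0 (fun k => a k y) n)
      (fun n y => sum_f_R0 (fun k => a1 k y) n) _ (fun y => a1 (j y) y) x x one); auto.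
    + intros y n _. apply is_derive_Reals, Dsum. intros k w. apply HC.
    + now apply disjoint_sum_CVU.
  - apply (derivable_pt_lim_CVU (fun n y => sum_f_R0 (fun k => a1 k y) n)
      (fun n y => sum_f_R0 (fun k => a2 k y) n) _ (fun y => a2 (j y) y) x x one); auto.
    + intros y n _. apply is_derive_Reals, Dsum. intros k w. apply HC.
    + now apply disjoint_sum_CVU.
Qed.

(** * Derivatives within the unit interval *)

Lemma limit1_in_ext (f g : R -> R) (D : R -> Prop) (l x : R) :
  (forall y, D y -> f y = g y) -> limit1_in f D l x -> limit1_in g D l x.
Proof.
  intros E H e He. destruct (H e He) as (d & Hd & Hf). exists d. split; auto.
  intros y Hy. rewrite <- E by apply Hy. auto.
Qed.

Lemma D_in_ext (f f1 g g1 : R -> R) (x : R) :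
  eq01 f g -> eq01 f1 g1 -> I01 x -> D_in f f1 I01 x -> D_in g g1 I01 x.
Proof.
  intros E E1 Hx H. unfold D_in. rewrite <- E1 by auto.
  revert H. apply limit1_in_ext. intros y [Hy _]. now rewrite !E.
Qed.

Lemma continue_in_ext (f g : R -> R) (x : R) :
  eq01 f g -> I01 x -> continue_in f I01 x -> continue_in g I01 x.
Proof.
  intros E Hx H. unfold continue_in. rewrite <- E by auto.
  revert H. apply limit1_in_ext. intros y [Hy _]. now apply E.
Qed.

Lemma is_derive_D_in (f f1 : R -> R) (x : R) :
  is_derive f x (f1 x) -> D_in f f1 I01 x.
Proof.
  intros H. apply is_derive_Reals in H. apply derivable_pt_lim_D_in in H.
  intros e He. destruct (H e He) as (d & Hd & Hf). exists d. split; auto.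
  intros y [[_ Hy] Hy']. apply Hf. split; auto. now split.
Qed.

Lemma continuity_pt_continue_in (f : R -> R) (x : R) :
  continuity_pt f x -> continue_in f I01 x.
Proof.
  intros H e He. destruct (H e He) as (d & Hd & Hf). exists d. split; auto.
  intros y [[_ Hy] Hy']. apply Hf. split; auto. now split; auto.
Qed.

Lemma D_in_is_derive (f f1 : R -> R) (x : R) :
  0 < x < 1 -> D_in f f1 I01 x -> is_derive f x (f1 x).
Proof.
  intros Hx H. apply is_derive_Reals, derivable_pt_lim_D_in.
  intros e He. destruct (H e He) as (d & Hd & Hf).
  assert (0 < Rmin d (Rmin x (1 - x))) by (repeat apply Rmin_glb_lt; lra).
  exists (Rmin d (Rmin x (1 - x))). split; auto.
  intros y [[_ Hy] Hy']. simpl in Hy'. unfold Rdist in Hy'.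
  pose proof (Rmin_l d (Rmin x (1 - x))). pose proof (Rmin_r d (Rmin x (1 - x))).
  pose proof (Rmin_l x (1 - x)). pose proof (Rmin_r x (1 - x)).
  apply Hf. split.
  - split; auto. assert (Rabs (y - x) < Rmin x (1 - x)) by lra.
    apply Rabs_def2 in H5. unfold I01. lra.
  - simpl. unfold Rdist. lra.
Qed.

(** Makes limits within [[0, 1]] unique, endpoints included, so that the description in [deriv] has
    a determined value. *)
Lemma I01_adherent (x : R) : I01 x -> adhDa (D_x I01 x) x.
Proof.
  intros Hx e He. unfold I01, D_x, Rdist in *.
  set (r := Rmin (e / 2) (1 / 2)).
  assert (0 < r <= 1 / 2 /\ r < e).
  { unfold r. pose proof (Rmin_l (e / 2) (1 / 2)). pose proof (Rmin_r (e / 2) (1 / 2)).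
    assert (0 < Rmin (e / 2) (1 / 2)) by (apply Rmin_glb_lt; lra). lra. }
  destruct (Rle_dec x (1 / 2)).
  - exists (x + r). repeat split; try lra. apply Rabs_def1; lra.
  - exists (x - r). repeat split; try lra. apply Rabs_def1; lra.
Qed.

Lemma deriv_unique (f f1 : R -> R) (x : R) :
  I01 x -> D_in f f1 I01 x -> deriv f x = f1 x.
Proof.
  intros Hx H. unfold deriv. apply (@iota_unique _ R_CompleteNormedModule); auto.
  intros l Hl. exact (single_limit _ _ _ _ _ (I01_adherent x Hx) Hl H).
Qed.

(** Bridge from explicit derivatives to [deriv_n]. Agreement of [g] with [f] on [[0, 1]] is all that
    is available for iterated renormalizations. *)
Lemma C2_at_deriv (f f1 f2 g : R -> R) :
  (forall x, I01 x -> D_in f f1 I01 x) -> (forall x, I01 x -> D_in f1 f2 I01 x) ->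
  (forall x, I01 x -> continue_in f2 I01 x) -> eq01 f g ->
  C_k 1 g /\ C_k 2 g /\ eq01 (deriv_n 1 g) f1 /\ eq01 (deriv_n 2 g) f2.
Proof.
  intros H0 H1 H2 E.
  assert (E1 : eq01 f1 (deriv_n 1 g)).
  { intros x Hx. symmetry. apply deriv_unique; auto.
    apply (D_in_ext f f1); auto. now intros y Hy. }
  assert (E2 : eq01 f2 (deriv_n 2 g)).
  { intros x Hx. symmetry. apply deriv_unique; auto.
    apply (D_in_ext f1 f2); auto. now intros y Hy. }
  assert (D0 : forall x, I01 x -> D_in g (deriv_n 1 g) I01 x)
    by (intros x Hx; now apply (D_in_ext f f1); auto).
  assert (D1 : forall x, I01 x -> D_in (deriv_n 1 g) (deriv_n 2 g) I01 x)
    by (intros x Hx; now apply (D_in_ext f1 f2); auto).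
  assert (Cont : forall x, I01 x -> continue_in (deriv_n 1 g) I01 x).
  { intros x Hx. eapply cont_deriv, D1, Hx. }
  split; [|split; [|split; intros x Hx; symmetry; auto]]; split.
  - intros j x Hj Hx. now replace j with 0%nat by lia; apply D0.
  - auto.
  - intros j x Hj Hx. assert (j = 0 \/ j = 1)%nat as [-> | ->] by lia; auto.
  - intros x Hx. apply (continue_in_ext f2); auto.
Qed.

(** * Extension of maps from the unit interval to the line *)

Definition clamp (x : R) : R := Rmax 0 (Rmin 1 x).

Lemma clamp_I01 (x : R) : I01 (clamp x).
Proof.
  unfold I01, clamp. split; [apply Rmax_l|].
  apply Rmax_lub; [lra | apply Rmin_l].
Qed.

Lemma clamp_id (x : R) : I01 x -> clamp x = x.
Proof.
  intros [H0 H1]. unfold clamp. now rewrite Rmin_right, Rmax_right by (rewrite ?Rmin_right; auto).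
Qed.

Lemma clamp_lipschitz (x y : R) : Rabs (clamp y - clamp x) <= Rabs (y - x).
Proof.
  unfold clamp, Rmax, Rmin, Rabs.
  repeat destruct Rle_dec; repeat destruct Rcase_abs; lra.
Qed.

Lemma continue_in_clamp (f : R -> R) :
  (forall x, I01 x -> continue_in f I01 x) ->
  forall x, continuity_pt (fun y => f (clamp y)) x.
Proof.
  intros H x e He. destruct (H _ (clamp_I01 x) e He) as (d & Hd & Hf).
  exists d. split; auto. intros y [_ Hy].
  (* [continue_in] only controls points other than [clamp x], and [clamp] may identify [y] with
     [x]. *)
  destruct (Req_dec (clamp y) (clamp x)) as [E|E].
  - rewrite E. simpl. unfold Rdist. rewrite Rminus_diag, Rabs_R0. auto.
  - apply Hf. split.
    + split; auto. apply clamp_I01.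
    + simpl in *. unfold Rdist in *. pose proof (clamp_lipschitz x y). lra.
Qed.

Lemma continuous_primitive (g : R -> R) (a : R) :
  (forall x, continuity_pt g x) ->
  exists P, P 0 = a /\ forall x, is_derive P x (g x).
Proof.
  intros Hg.
  assert (Hc : forall x, continuous g x) by (intros; now apply continuity_pt_filterlim).
  exists (fun x => a + RInt g 0 x). split.
  - rewrite RInt_point. unfold zero. simpl. lra.
  - intros x. replace (g x) with (0 + g x) by lra. apply @is_derive_plus.
    + apply @is_derive_const.
    + apply (is_derive_RInt g (RInt g 0) 0 x); auto.
      apply filter_forall. intros y. apply (@RInt_correct R_CompleteNormedModule).
      apply (@ex_RInt_continuous R_CompleteNormedModule). auto.
Qed.

(** The difference has zero derivative inside, and the mean value theorem asks only for continuity
    at the ends; composing [f] with [clamp] makes that continuity two-sided. *)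
Lemma D_in_primitive_unique (f g P : R -> R) :
  (forall x, I01 x -> D_in f g I01 x) -> (forall x, I01 x -> is_derive P x (g x)) ->
  P 0 = f 0 -> eq01 P f.
Proof.
  intros Hf HP E0 x Hx. unfold I01 in *.
  destruct (Req_dec x 0) as [->|Hx0]; auto.
  destruct (MVT_gen (fun y => f (clamp y) - P y) 0 x (fun _ => 0)) as (z & _ & E).
  - rewrite Rmin_left, Rmax_right by lra. intros y Hy.
    replace 0 with (g y - g y) by lra. apply @is_derive_minus; [|apply HP; lra].
    apply (is_derive_ext_loc f).
    + assert (Hr : 0 < Rmin y (1 - y)) by (apply Rmin_glb_lt; lra).
      exists (mkposreal _ Hr). intros w Hw. rewrite clamp_id; auto.
      unfold ball in Hw; simpl in Hw. unfold AbsRing_ball, abs, minus, plus, opp in Hw; simpl in Hw.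
      pose proof (Rmin_l y (1 - y)). pose proof (Rmin_r y (1 - y)).
      apply Rabs_def2 in Hw. unfold I01. lra.
    + apply D_in_is_derive; [lra | apply Hf; lra].
  - rewrite Rmin_left, Rmax_right by lra. intros y Hy. apply continuity_pt_minus.
    + apply continue_in_clamp. intros w Hw. eapply cont_deriv, Hf, Hw.
    + eapply is_derive_continuity_pt, HP. lra.
  - rewrite !clamp_id in E by (unfold I01; lra). lra.
Qed.

(** The second derivative is extended by constants and integrated twice, after which ordinary
    two-sided calculus applies everywhere. *)
Lemma C2_extension (F : R -> R) :
  C_k 2 F ->
  exists G G1 G2, (forall x, C2_at G G1 G2 x) /\
    eq01 G F /\ eq01 G1 (deriv_n 1 F) /\ eq01 G2 (deriv_n 2 F).
Proof.
  intros [HD HC].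
  assert (C2 := continue_in_clamp _ HC).
  destruct (continuous_primitive _ (deriv_n 1 F 0) C2) as (G1 & E1 & D1).
  assert (C1 : forall x, continuity_pt G1 x)
    by (intros x; eapply is_derive_continuity_pt, D1).
  destruct (continuous_primitive _ (F 0) C1) as (G & E0 & D0).
  assert (Q1 : eq01 G1 (deriv_n 1 F)).
  { apply (D_in_primitive_unique _ (deriv_n 2 F)); auto.
    intros x Hx. rewrite <- (clamp_id x Hx) at 2. apply D1. }
  assert (Q0 : eq01 G F).
  { apply (D_in_primitive_unique _ (deriv_n 1 F)); auto.
    - intros x Hx. apply (HD 0%nat); auto.
    - intros x Hx. rewrite <- Q1 by auto. apply D0. }
  exists G, G1, (fun x => deriv_n 2 F (clamp x)).
  split; [|split; [|split]]; auto.
  - intros x. split; [|split]; auto.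
  - intros x Hx. now rewrite clamp_id.
Qed.

(** * The fixed point *)

(* Here [p = F^3 c] and [s = F^4 c], so that [I_0^1 = [0, s]], [I_1^1 = [p, 1]], and
   [h t = s (1 - t)] is the rescaling map, whose fixed point is [c]. *)
Record fixed_point_data (F F1 F2 : R -> R) (c p s : R) : Prop := {
  fp_C2 : forall x, C2_at F F1 F2 x;
  fp_pos : forall x, 0 < x < c -> 0 < F1 x;
  fp_neg : forall x, c < x < 1 -> F1 x < 0;
  fp_I01 : forall x, I01 x -> I01 (F x);
  fp_deriv_c : F1 c = 0;
  fp_c : F c = 1;
  fp_1 : F 1 = 0;
  fp_0 : F 0 = p;
  fp_p : F p = s;
  fp_order : 0 < c < s /\ s < p < 1;
  fp_image : forall x, 0 <= x <= s -> p <= F x;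
  fp_center : c = s * (1 - c);
  fp_fixed : forall t, I01 t -> F (F (s * (1 - t))) = s * (1 - F t) }.

Lemma fixed_increasing (F F1 F2 : R -> R) (c p s : R) :
  fixed_point_data F F1 F2 c p s ->
  forall x y, 0 <= x -> x < y -> y <= c -> F x < F y.
Proof.
  intros D x y Hx Hxy Hy. apply (derive_pos_increasing F F1); auto.
  - intros z _. apply (fp_C2 _ _ _ _ _ _ D).
  - intros z Hz. apply (fp_pos _ _ _ _ _ _ D). lra.
Qed.

Lemma fixed_decreasing (F F1 F2 : R -> R) (c p s : R) :
  fixed_point_data F F1 F2 c p s ->
  forall x y, c <= x -> x < y -> y <= 1 -> F y < F x.
Proof.
  intros D x y Hx Hxy Hy. apply (derive_neg_decreasing F F1); auto.
  - intros z _. apply (fp_C2 _ _ _ _ _ _ D).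
  - intros z Hz. apply (fp_neg _ _ _ _ _ _ D). lra.
Qed.

Lemma continuous_nonzero_sign (f : R -> R) (a b : R) :
  continuity f -> (forall x, a < x < b -> f x <> 0) ->
  (forall x, a < x < b -> 0 < f x) \/ (forall x, a < x < b -> f x < 0).
Proof.
  intros Hc Hn.
  assert (Same : forall x y, a < x < b -> a < y < b -> f x <= 0 <= f y -> False).
  { intros x y Hx Hy Hs. destruct (IVT_gen f x y 0 Hc) as (z & Hz & E).
    - rewrite Rmin_left, Rmax_right; lra.
    - apply (Hn z); auto. revert Hz. unfold Rmin, Rmax. destruct Rle_dec; lra. }
  destruct (classic (exists x, a < x < b /\ 0 < f x)) as [(x & Hx & Px)|No].
  - left. intros y Hy. apply Rnot_le_lt. intros Hle. apply (Same y x); auto; lra.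
  - right. intros y Hy. specialize (Hn y Hy). apply Rnot_le_lt. intros Hle.
    apply No. exists y. split; auto. lra.
Qed.

Lemma critical_crit (f : R -> R) : unimodal f -> critical f (crit f).
Proof.
  intros (_ & _ & _ & E & _). unfold crit.
  exact (@iota_correct _ R_CompleteNormedModule (critical f) E).
Qed.

Lemma fixed_point_data_of (f : R -> R) :
  U 2 f -> renormalizable f -> eq01 (renorm f) f ->
  exists F F1 F2 p s, fixed_point_data F F1 F2 (crit f) p s /\
    eq01 F f /\ eq01 F1 (deriv_n 1 f) /\ eq01 F2 (deriv_n 2 f).
Proof.
  intros (Hu & HC2 & _) Hren Hfix.
  assert (Hcrit := critical_crit f Hu).
  destruct Hu as (HI & _ & H1 & Hex & Hc1).
  destruct (C2_extension f HC2) as (F & F1 & F2 & HC & E0 & E1 & E2).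
  set (c := crit f) in *. destruct Hcrit as [Hc Hdc].
  assert (Uniq : forall x, 0 < x < 1 -> F1 x = 0 -> x = c).
  { intros x Hx Hd. destruct Hex as (c' & _ & Hu).
    assert (critical f x).
    { split; auto. rewrite E1 in Hd; auto. unfold I01; lra. }
    rewrite <- (Hu x), <- (Hu c); auto. split; auto. }
  assert (Cont1 : continuity F1)
    by (intros x; apply (C2_at_continuity _ _ _ _ (HC x))).
  assert (FI : forall x, I01 x -> I01 (F x)) by (intros x Hx; rewrite E0; auto).
  assert (Ic : I01 c) by (unfold I01; lra).
  assert (I0 : I01 0) by (unfold I01; lra).
  assert (I1 : I01 1) by (unfold I01; lra).
  assert (Fc : F c = 1) by (rewrite E0; auto).
  assert (F_1 : F 1 = 0) by (rewrite E0; auto).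
  assert (HD : forall x, is_derive F x (F1 x)) by (intros x; apply HC).
  (* The opposite sign would give [F 0 > F c = 1], outside [[0, 1]]; on the right of [c] it would
     give [F 1 > 1]. *)
  assert (Pos : forall x, 0 < x < c -> 0 < F1 x).
  { destruct (continuous_nonzero_sign F1 0 c Cont1) as [P|N]; auto.
    - intros x Hx E. assert (x = c) by (apply Uniq; lra). lra.
    - exfalso. assert (F c < F 0) by (apply (derive_neg_decreasing F F1); auto; lra).
      destruct (FI 0 I0). lra. }
  assert (Neg : forall x, c < x < 1 -> F1 x < 0).
  { destruct (continuous_nonzero_sign F1 c 1 Cont1) as [P|N]; auto.
    - intros x Hx E. assert (x = c) by (apply Uniq; lra). lra.
    - exfalso. assert (F c < F 1) by (apply (derive_pos_increasing F F1); auto; lra).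
      lra. }
  set (p := F 0). set (s := F p).
  assert (Ip : I01 p) by (apply FI; auto).
  assert (Is : I01 s) by (apply FI; auto).
  assert (O1 : orb f 1 = 1) by (exact Hc1).
  assert (O2 : orb f 2 = 0) by (change (f (orb f 1) = 0); now rewrite O1).
  assert (O3 : orb f 3 = p)
    by (change (f (orb f 2) = p); rewrite O2, <- E0; auto).
  assert (O4 : orb f 4 = s)
    by (change (f (orb f 3) = s); rewrite O3, <- E0; auto).
  destruct Hren as (R1 & R2 & R3).
  unfold I_0_1, I_1_1 in *. rewrite O1, O2, O3, O4 in *. fold c in R1.
  assert (s < p).
  { apply Rnot_le_lt. intros Hle. apply (R3 p). unfold I01 in *. lra. }
  assert (p < 1).
  { unfold p. rewrite <- Fc. apply (derive_pos_increasing F F1); auto; lra. }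
  assert (Fixed : forall t, I01 t -> F (F (s * (1 - t))) = s * (1 - F t)).
  { intros t Ht. assert (I01 (s * (1 - t))) by (unfold I01 in *; nra).
    specialize (Hfix t Ht). unfold renorm, h_inv, h in Hfix. rewrite O2, O4 in Hfix.
    replace (s + t * (0 - s)) with (s * (1 - t)) in Hfix by ring.
    rewrite (E0 t Ht), (E0 (s * (1 - t))), E0, <- Hfix by (rewrite <- ?E0; auto).
    field. lra. }
  (* The point [1 - c / s] is the [h]-preimage of [c]. There the fixed point equation reads
     [F (F c) = 0 = s * (1 - F (1 - c / s))], so [F] takes its maximum [1], which happens only at
     [c]. *)
  assert (Center : c = s * (1 - c)).
  { assert (It : I01 (1 - c / s)).
    { assert (c / s * s = c) by (field; lra). unfold I01. nra. }
    assert (Ft : F (1 - c / s) = 1).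
    { specialize (Fixed _ It).
      replace (s * (1 - (1 - c / s))) with c in Fixed by (field; lra).
      rewrite Fc, F_1 in Fixed. nra. }
    assert (Ec : 1 - c / s = c).
    { unfold I01 in It.
      destruct (Rtotal_order (1 - c / s) c) as [Hlt|[Heq|Hgt]]; auto; exfalso.
      - assert (F (1 - c / s) < F c) by (apply (derive_pos_increasing F F1); auto; intros; apply Pos; lra).
        lra.
      - assert (F (1 - c / s) < F c) by (apply (derive_neg_decreasing F F1); auto; intros; apply Neg; lra).
        lra. }
    rewrite <- Ec at 2. field. lra. }
  exists F, F1, F2, p, s. split; [|auto].
  constructor; auto.
  - rewrite E1; auto.
  - split; [split; [lra|]|lra]. nra.
  - intros x Hx. rewrite E0 by (unfold I01 in *; lra).
    apply (proj1 (R2 (f x))). now exists x.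
Qed.

(** * A bump function and inverse functions *)

(** At the corner [0], an exponent of at least two bounds the difference quotient by [Rabs h] for
    [Rabs h <= 1]. *)
Lemma is_derive_pos_part_pow (n : nat) (x : R) :
  is_derive (fun u => Rmax 0 u ^ (S (S n))) x (INR (S (S n)) * Rmax 0 x ^ (S n)).
Proof.
  destruct (Rtotal_order x 0) as [Hx|[->|Hx]].
  - apply (is_derive_ext_loc (fun _ => 0)).
    + apply (locally_open (fun u => u < 0)); auto using open_lt.
      intros u Hu. rewrite Rmax_left by lra. simpl. ring.
    + rewrite Rmax_left by lra. simpl (0 ^ S n). rewrite Rmult_0_l, Rmult_0_r.
      apply @is_derive_const.
  - apply is_derive_Reals. intros e He.
    assert (Hr : 0 < Rmin e 1) by (apply Rmin_glb_lt; lra).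
    exists (mkposreal _ Hr). intros h Hh0 Hh. simpl in Hh.
    pose proof (Rmin_l e 1). pose proof (Rmin_r e 1).
    rewrite Rplus_0_l, (Rmax_left 0 0) by lra. simpl (0 ^ _).
    rewrite !Rmult_0_l, Rmult_0_r, !Rminus_0_r. unfold Rdiv.
    rewrite Rabs_mult, Rabs_inv. simpl pow.
    assert (Hh' : 0 < Rabs h) by now apply Rabs_pos_lt.
    assert (Hm : 0 <= Rmax 0 h <= Rabs h).
    { unfold Rmax, Rabs. destruct Rle_dec, Rcase_abs; lra. }
    set (m := Rmax 0 h) in *.
    assert (0 <= m ^ n <= 1).
    { split; [apply pow_le; lra|]. rewrite <- (pow1 n). apply pow_incr. lra. }
    rewrite Rabs_pos_eq by (repeat apply Rmult_le_pos; lra).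
    apply Rle_lt_trans with (Rabs h); [|lra].
    apply (Rmult_le_reg_r (Rabs h)); auto. field_simplify; [|lra].
    nra.
  - apply (is_derive_ext_loc (fun u => u ^ S (S n))).
    + apply (locally_open (fun u => 0 < u)); auto using open_gt.
      intros u Hu. now rewrite Rmax_right by lra.
    + rewrite Rmax_right by lra. apply is_derive_Reals.
      apply (derivable_pt_lim_pow x (S (S n))).
Qed.

Lemma continuity_pt_pos_part (x : R) : continuity_pt (Rmax 0) x.
Proof.
  intros e He. exists e. split; auto. intros y [_ Hy]. simpl in *. unfold Rdist in *.
  apply Rle_lt_trans with (2 := Hy). unfold Rmax, Rabs.
  repeat destruct Rle_dec; repeat destruct Rcase_abs; lra.
Qed.

(** The cube is the lowest integer power of the positive part that is [C^2]. *)
Definition bump (a b x : R) : R := Rmax 0 ((x - a) * (b - x)) ^ 3.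
Definition bump1 (a b x : R) : R :=
  3 * Rmax 0 ((x - a) * (b - x)) ^ 2 * (a + b - 2 * x).
Definition bump2 (a b x : R) : R :=
  6 * Rmax 0 ((x - a) * (b - x)) * (a + b - 2 * x) ^ 2
  - 6 * Rmax 0 ((x - a) * (b - x)) ^ 2.

Lemma bump_C2 (a b x : R) : C2_at (bump a b) (bump1 a b) (bump2 a b) x.
Proof.
  assert (Q : C2_at (fun y => (y - a) * (b - y)) (fun y => a + b - 2 * y) (fun _ => -2) x).
  { split; [|split].
    - auto_derive; auto; ring.
    - auto_derive; auto; ring.
    - apply continuity_pt_const. now intros u v. }
  assert (P : C2_at (fun u => Rmax 0 u ^ 3) (fun u => 3 * Rmax 0 u ^ 2) (fun u => 6 * Rmax 0 u)
    ((x - a) * (b - x))).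
  { split; [|split].
    - replace 3 with (INR 3) by (simpl; ring). apply is_derive_pos_part_pow.
    - replace (6 * Rmax 0 ((x - a) * (b - x))) with (3 * (2 * Rmax 0 ((x - a) * (b - x)) ^ 1)) by ring.
      apply is_derive_scal. replace 2 with (INR 2) at 3 by (simpl; ring).
      apply is_derive_pos_part_pow.
    - apply continuity_pt_scal, continuity_pt_pos_part. }
  generalize (C2_at_comp _ _ _ _ _ _ _ P Q). apply C2_at_ext_loc.
  apply filter_forall. intros y. unfold bump, bump1, bump2. repeat split; ring.
Qed.

Lemma bump_zero (a b x : R) : a <= b -> x <= a \/ b <= x ->
  bump a b x = 0 /\ bump1 a b x = 0 /\ bump2 a b x = 0.
Proof.
  intros Hab Hx. unfold bump, bump1, bump2.
  rewrite Rmax_left by (destruct Hx; nra). repeat split; ring.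
Qed.

Lemma bump_pos (a b x : R) : a < x < b -> 0 < bump a b x.
Proof.
  intros Hx. unfold bump. apply pow_lt. rewrite Rmax_right; nra.
Qed.

(** Both [(x - a) * (b - x)] and [a + b - 2 * x] are at most [1] in size on the window; [12 = 6 + 6]
    comes from the two terms of [bump2]. *)
Lemma bump_bounds (a b x : R) : 0 <= a <= b -> b <= 1 ->
  Rabs (bump a b x) <= 12 /\ Rabs (bump1 a b x) <= 12 /\ Rabs (bump2 a b x) <= 12.
Proof.
  intros Ha Hb.
  destruct (Rlt_dec a x) as [Hax|Hax]; [destruct (Rlt_dec x b) as [Hxb|Hxb]|].
  2, 3: destruct (bump_zero a b x) as (-> & -> & ->); rewrite ?Rabs_R0; lra.
  unfold bump, bump1, bump2. rewrite Rmax_right by nra.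
  set (m := (x - a) * (b - x)). set (w := a + b - 2 * x).
  assert (0 <= m <= 1) by (unfold m; nra).
  assert (-1 <= w <= 1) by (unfold w; lra).
  assert (0 <= m ^ 2 <= 1) by nra.
  assert (0 <= w ^ 2 <= 1) by nra.
  assert (0 <= m ^ 3 <= 1) by nra.
  assert (0 <= m * w ^ 2 <= 1) by nra.
  repeat split; apply Rabs_le; nra.
Qed.

Lemma derive_pos_surjective (g g1 : R -> R) (A B y : R) :
  A < B -> (forall x, is_derive g x (g1 x)) -> g A < y < g B ->
  exists x, A < x < B /\ g x = y.
Proof.
  intros HAB Hd Hy. destruct (IVT_gen g A B y) as (x & Hx & E).
  - intros x. eapply is_derive_continuity_pt, Hd.
  - rewrite Rmin_left, Rmax_right; lra.
  - rewrite Rmin_left, Rmax_right in Hx by lra. exists x. split; auto.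
    split; apply Rnot_le_lt; intros Hle.
    + replace x with A in E by lra. lra.
    + replace x with B in E by lra. lra.
Qed.

(** [u] is a mere choice of preimages. Strict monotonicity of [g] makes it continuous, the rule for
    inverses then gives its derivative, and differentiating [/ g1 (u z)] gives the second one. *)
Lemma inverse_C2 (g g1 g2 u : R -> R) (A B : R) :
  A < B -> (forall x, C2_at g g1 g2 x) -> (forall x, A < x < B -> 0 < g1 x) ->
  (forall y, g A < y < g B -> A < u y < B /\ g (u y) = y) ->
  forall y, g A < y < g B ->
    C2_at u (fun z => / g1 (u z)) (fun z => - g2 (u z) / g1 (u z) ^ 3) y.
Proof.
  intros HAB HC Hpos Hu.
  assert (HD : forall x, is_derive g x (g1 x)) by (intros x; apply HC).
  assert (Mono : forall x x', A <= x -> x < x' -> x' <= B -> g x < g x').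
  { intros x x' ? ? ?. apply (derive_pos_increasing g g1); auto.
    intros; apply Hpos; lra. }
  assert (Cu : forall y, g A < y < g B -> continuity_pt u y).
  { intros y Hy e He. destruct (Hu y Hy) as [Hx E].
    set (x := u y) in *.
    set (r := Rmin (e / 2) (Rmin ((x - A) / 2) ((B - x) / 2))).
    assert (0 < r) by (unfold r; repeat apply Rmin_glb_lt; lra).
    assert (r <= e / 2) by apply Rmin_l.
    assert (r <= (x - A) / 2).
    { eapply Rle_trans; [apply Rmin_r | apply Rmin_l]. }
    assert (r <= (B - x) / 2).
    { eapply Rle_trans; [apply Rmin_r | apply Rmin_r]. }
    assert (g (x - r) < y) by (rewrite <- E; apply Mono; lra).
    assert (y < g (x + r)) by (rewrite <- E; apply Mono; lra).
    assert (g A < g (x - r)) by (apply Mono; lra).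
    assert (g (x + r) < g B) by (apply Mono; lra).
    exists (Rmin (y - g (x - r)) (g (x + r) - y)).
    split; [apply Rmin_glb_lt; lra|]. intros z [_ Hz]. simpl in *. unfold Rdist in *.
    pose proof (Rmin_l (y - g (x - r)) (g (x + r) - y)).
    pose proof (Rmin_r (y - g (x - r)) (g (x + r) - y)).
    apply Rabs_def2 in Hz.
    destruct (Hu z) as [Hz' Ez]; [lra|].
    assert (x - r < u z).
    { apply Rnot_le_lt. intros [Hle|Hle].
      - assert (g (u z) < g (x - r)) by (apply Mono; lra). lra.
      - rewrite Hle in Ez. lra. }
    assert (u z < x + r).
    { apply Rnot_le_lt. intros [Hle|Hle].
      - assert (g (x + r) < g (u z)) by (apply Mono; lra). lra.
      - rewrite <- Hle in Ez. lra. }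
    fold x. apply Rabs_def1; lra. }
  assert (Du : forall y, g A < y < g B -> is_derive u y (/ g1 (u y))).
  { intros y Hy. destruct (Hu y Hy) as [Hx E]. apply is_derive_Reals.
    (* The rule for inverses works on a closed interval, so [y] is enclosed between two
       midpoints. *)
    set (lb := (g A + y) / 2). set (ub := (y + g B) / 2).
    assert (Hb : g A < lb < y /\ y < ub < g B) by (unfold lb, ub; lra).
    assert (Inc : u lb <= u y <= u ub).
    { destruct (Hu lb) as [? El]; [lra|]. destruct (Hu ub) as [? Eu]; [lra|].
      split; apply Rnot_lt_le; intros Hlt.
      - assert (g (u y) < g (u lb)) by (apply Mono; lra). lra.
      - assert (g (u ub) < g (u y)) by (apply Mono; lra). lra. }
    set (prf := fun (x : R) (_ : u lb <= x <= u ub) =>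
      exist _ (g1 x) (proj1 (is_derive_Reals g x (g1 x)) (HD x)) : derivable_pt g x).
    replace (/ g1 (u y)) with (1 / derive_pt g (u y) (prf (u y) Inc))
      by (simpl; field; specialize (Hpos _ Hx); lra).
    apply derivable_pt_lim_recip_interv; auto; try lra.
    - intros z Hz. change (g (u z) = z). apply (Hu z). lra.
    - simpl. specialize (Hpos _ Hx). lra. }
  intros y Hy. destruct (Hu y Hy) as [Hx _]. assert (Hp := Hpos _ Hx).
  assert (Dc : is_derive (fun z => g1 (u z)) y (/ g1 (u y) * g2 (u y))).
  { apply (is_derive_comp g1 u); [apply HC | apply Du, Hy]. }
  split; [|split].
  - now apply Du.
  - replace (- g2 (u y) / g1 (u y) ^ 3) with (- (/ g1 (u y) * g2 (u y)) / g1 (u y) ^ 2)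
      by (field; lra).
    apply (is_derive_inv (fun z => g1 (u z))); auto. lra.
  - apply continuity_pt_div.
    + apply continuity_pt_opp. apply (continuity_pt_comp u g2); [now apply Cu | apply HC].
    + apply (continuity_pt_comp (fun z => g1 (u z)) (fun v => v ^ 3)).
      * eapply is_derive_continuity_pt, Dc.
      * apply derivable_continuous_pt, derivable_pt_pow.
    + apply pow_nonzero. lra.
Qed.

(** * The displacement on the two windows *)

(* [(a, b)] lies in the image under [h] of the gap [(s, p)]; the last condition
   makes it the only part of [[0, s]] that [F] maps into [(F a, F b)]. *)
Record gap_window (F : R -> R) (c p s a b : R) : Prop := {
  gw_a : s * (1 - p) < a;
  gw_ab : a < b;
  gw_bc : b < c;
  gw_bs : b < s * (1 - s);
  gw_Fb : F b < F s }.

(** The window is placed just to the right of [x0 = h p], the left end of the image of the gap. The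
    key is [F x0 < F s]: it forces [x0 < c] and leaves room for [F b < F s]. *)
Lemma gap_window_exists (F F1 F2 : R -> R) (c p s : R) :
  fixed_point_data F F1 F2 c p s -> exists a b, gap_window F c p s a b.
Proof.
  intros D. assert (Dec := fixed_decreasing _ _ _ _ _ _ D).
  destruct D as [HC _ _ HI _ Fc F_1 F_0 Fp [Hcs [Hsp Hp1]] Him Hctr Hfix].
  set (x0 := s * (1 - p)).
  assert (Hx0 : 0 < x0 < s) by (unfold x0; nra).
  assert (Hx1 : x0 < s * (1 - s)) by (unfold x0; nra).
  assert (E1 : F (F x0) = s * (1 - s)).
  { unfold x0. rewrite Hfix by (unfold I01; lra). now rewrite Fp. }
  assert (E2 : F (F s) = x0).
  { replace s with (s * (1 - 0)) at 1 by ring.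
    rewrite Hfix by (unfold I01; lra). now rewrite F_0. }
  (* [F^2] maps the order [x0 < s] to the order of [F p < F 0], and [F] reverses
     order on [[p, 1]]. *)
  assert (Hlt : F x0 < F s).
  { assert (I01 (F x0)) by (apply HI; unfold I01; lra).
    assert (p <= F s) by (apply Him; lra). unfold I01 in *.
    apply Rnot_le_lt. intros [Hle|Hle].
    - assert (F (F x0) < F (F s)) by (apply Dec; lra). lra.
    - rewrite Hle in E2. lra. }
  assert (Hx0c : x0 < c).
  { apply Rnot_le_lt. intros Hle. assert (F s < F x0) by (apply Dec; lra). lra. }
  assert (Cx : continuity_pt F x0) by apply (C2_at_continuity _ _ _ _ (HC x0)).
  destruct (Cx (F s - F x0)) as (d & Hd & HF); [lra|].
  set (r := Rmin (d / 2) (Rmin ((c - x0) / 2) ((s * (1 - s) - x0) / 2))).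
  assert (0 < r) by (unfold r; repeat apply Rmin_glb_lt; lra).
  assert (r <= d / 2) by apply Rmin_l.
  assert (r <= (c - x0) / 2) by (eapply Rle_trans; [apply Rmin_r | apply Rmin_l]).
  assert (r <= (s * (1 - s) - x0) / 2) by (eapply Rle_trans; [apply Rmin_r | apply Rmin_r]).
  exists (x0 + r / 2), (x0 + r). fold x0. constructor; try (fold x0; lra).
  assert (B : Rabs (F (x0 + r) - F x0) < F s - F x0).
  { apply HF. split; [split; [exact I | lra]|]. simpl. unfold Rdist. apply Rabs_def1; lra. }
  apply Rabs_def2 in B. lra.
Qed.

Section Displacement.

Context (F F1 F2 : R -> R) (c p s a b : R).
Context (D : fixed_point_data F F1 F2 c p s) (W : gap_window F c p s a b).

Definition psi (t x : R) : R := x + t * bump a b x.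
Definition psi1 (t x : R) : R := 1 + t * bump1 a b x.
Definition psi2 (t x : R) : R := t * bump2 a b x.

Definition Fpsi (t x : R) : R := F (psi t x).
Definition Fpsi1 (t x : R) : R := F1 (psi t x) * psi1 t x.
Definition Fpsi2 (t x : R) : R :=
  F2 (psi t x) * psi1 t x ^ 2 + F1 (psi t x) * psi2 t x.

(** Meaningful for [p < y < 1]. Inverting the whole left branch, not only its part over
    [(F a, F b)], keeps the formula smooth across the ends of the second window. *)
Definition Fpsi_inv (t y : R) : R :=
  epsilon (inhabits 0) (fun x => 0 < x < c /\ Fpsi t x = y).

Definition on_p1 (A B : R -> R) (x : R) : R :=
  if Rlt_dec p x then if Rlt_dec x 1 then A x else B x else B x.

(* The displacement [X_t - id] of a map [X_t] supported in the two windows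
   [(a, b)] and [(F a, F b)]: on the first one [X_t = psi t], on the second one
   [F (X_t y) = F (F x)] for [y = F (psi t x)], so that [F o X_t o F o X_t]
   agrees with [F o F] on [(a, b)]. *)
Definition disp (t : R) : R -> R :=
  on_p1 (fun y => F (Fpsi_inv t y) - y) (fun x => t * bump a b x).
Definition disp1 (t : R) : R -> R :=
  on_p1 (fun y => F1 (Fpsi_inv t y) * / Fpsi1 t (Fpsi_inv t y) - 1)
    (fun x => t * bump1 a b x).
Definition disp2 (t : R) : R -> R :=
  on_p1 (fun y => let x := Fpsi_inv t y in
           F2 x * (/ Fpsi1 t x) ^ 2 + F1 x * (- Fpsi2 t x / Fpsi1 t x ^ 3))
    (fun x => t * bump2 a b x).

Definition in_window (x : R) : Prop := a < x < b \/ F a < x < F b.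

Lemma window_order :
  0 < a /\ a < b /\ b < c /\ c < s /\ s < p /\ p < F a /\ F a < F b /\ F b < F s /\ F b < 1 /\ p < 1.
Proof.
  assert (Inc := fixed_increasing _ _ _ _ _ _ D).
  destruct D as [_ _ _ _ _ Fc _ F_0 _ [Hcs [Hsp Hp1]] _ _ _]. destruct W.
  assert (0 < a) by nra.
  assert (F 0 < F a) by (apply Inc; lra).
  assert (F a < F b) by (apply Inc; lra).
  assert (F b < F c) by (apply Inc; lra).
  lra.
Qed.

Lemma on_p1_in (A B : R -> R) (x : R) : p < x < 1 -> on_p1 A B x = A x.
Proof. intros Hx. unfold on_p1. repeat destruct Rlt_dec; auto; lra. Qed.

Lemma on_p1_out (A B : R -> R) (x : R) : x <= p \/ 1 <= x -> on_p1 A B x = B x.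
Proof. intros Hx. unfold on_p1. repeat destruct Rlt_dec; auto; lra. Qed.

(** With the bound [12] on [bump1], this keeps [psi1 t] above [1 - 12 / 24], that is, one half. *)
Definition small (t : R) : Prop := 0 <= t <= / 24.

Lemma psi_C2 (t x : R) : C2_at (psi t) (psi1 t) (psi2 t) x.
Proof.
  generalize (C2_at_plus _ _ _ _ _ _ x (C2_at_id x) (C2_at_scal t _ _ _ x (bump_C2 a b x))).
  apply C2_at_ext_loc, filter_forall. intros y. unfold psi, psi1, psi2. repeat split; ring.
Qed.

Lemma Fpsi_C2 (t x : R) : C2_at (Fpsi t) (Fpsi1 t) (Fpsi2 t) x.
Proof.
  exact (C2_at_comp F F1 F2 _ _ _ x (fp_C2 _ _ _ _ _ _ D _) (psi_C2 t x)).
Qed.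

Lemma bump_abs (x : R) :
  Rabs (bump a b x) <= 12 /\ Rabs (bump1 a b x) <= 12 /\ Rabs (bump2 a b x) <= 12.
Proof.
  pose proof window_order. destruct D as [_ _ _ _ _ _ _ _ _ ? _ _ _].
  apply bump_bounds; lra.
Qed.

Lemma bump_outside (x : R) : x <= a \/ b <= x ->
  bump a b x = 0 /\ bump1 a b x = 0 /\ bump2 a b x = 0.
Proof. apply bump_zero. pose proof window_order. lra. Qed.

Lemma psi1_pos (t x : R) : small t -> / 2 <= psi1 t x.
Proof.
  intros Ht. destruct (bump_abs x) as (_ & B & _). apply Rabs_le_between in B.
  unfold psi1, small in *. nra.
Qed.

Lemma psi_increasing (t x y : R) : small t -> x < y -> psi t x < psi t y.
Proof.
  intros Ht Hxy. apply (derive_pos_increasing (psi t) (psi1 t)); auto.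
  - intros z _. apply psi_C2.
  - intros z _. pose proof (psi1_pos t z Ht). lra.
Qed.

Lemma psi_outside (t x : R) : x <= a \/ b <= x ->
  psi t x = x /\ psi1 t x = 1 /\ psi2 t x = 0.
Proof.
  intros Hx. destruct (bump_outside x Hx) as (E & E1 & E2).
  unfold psi, psi1, psi2. rewrite E, E1, E2. repeat split; ring.
Qed.

Lemma psi_window (t x : R) : small t -> a < x < b -> a < psi t x < b.
Proof.
  intros Ht Hx. pose proof window_order.
  destruct (psi_outside t a) as (Ea & _); [lra|].
  destruct (psi_outside t b) as (Eb & _); [lra|].
  pose proof (psi_increasing t a x Ht). pose proof (psi_increasing t x b Ht). lra.
Qed.

Lemma psi_0c (t x : R) : small t -> 0 < x < c -> 0 < psi t x < c.
Proof.
  intros Ht Hx. pose proof window_order.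
  destruct (psi_outside t 0) as (Ea & _); [lra|].
  destruct (psi_outside t c) as (Eb & _); [lra|].
  pose proof (psi_increasing t 0 x Ht). pose proof (psi_increasing t x c Ht). lra.
Qed.

Lemma Fpsi1_pos (t x : R) : small t -> 0 < x < c -> 0 < Fpsi1 t x.
Proof.
  intros Ht Hx. unfold Fpsi1. apply Rmult_lt_0_compat.
  - apply (fp_pos _ _ _ _ _ _ D), psi_0c; auto.
  - pose proof (psi1_pos t x Ht). lra.
Qed.

Lemma Fpsi_ends (t : R) : Fpsi t 0 = p /\ Fpsi t c = 1.
Proof.
  pose proof window_order. unfold Fpsi.
  destruct (psi_outside t 0) as (-> & _); [lra|].
  destruct (psi_outside t c) as (-> & _); [lra|].
  destruct D; auto.
Qed.

Lemma Fpsi_increasing (t x y : R) :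
  small t -> 0 <= x -> x < y -> y <= c -> Fpsi t x < Fpsi t y.
Proof.
  intros Ht Hx Hxy Hy. apply (derive_pos_increasing (Fpsi t) (Fpsi1 t)); auto.
  - intros z _. apply Fpsi_C2.
  - intros z Hz. apply Fpsi1_pos; auto. lra.
Qed.

Lemma Fpsi_inv_spec (t y : R) :
  small t -> p < y < 1 -> 0 < Fpsi_inv t y < c /\ Fpsi t (Fpsi_inv t y) = y.
Proof.
  intros Ht Hy. pose proof window_order. destruct (Fpsi_ends t) as [E0 Ec].
  unfold Fpsi_inv. apply epsilon_spec.
  apply (derive_pos_surjective (Fpsi t) (Fpsi1 t)); try lra.
  intros x. apply Fpsi_C2.
Qed.

Lemma Fpsi_inv_unique (t x : R) :
  small t -> 0 < x < c -> Fpsi_inv t (Fpsi t x) = x.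
Proof.
  intros Ht Hx. destruct (Fpsi_ends t) as [E0 Ec].
  assert (Fpsi t 0 < Fpsi t x) by (apply Fpsi_increasing; auto; lra).
  assert (Fpsi t x < Fpsi t c) by (apply Fpsi_increasing; auto; lra).
  destruct (Fpsi_inv_spec t (Fpsi t x) Ht) as [Hv Ev]; [lra|].
  set (v := Fpsi_inv t (Fpsi t x)) in *.
  destruct (Rtotal_order v x) as [Hlt|[Heq|Hgt]]; auto; exfalso.
  - assert (Fpsi t v < Fpsi t x) by (apply Fpsi_increasing; auto; lra). lra.
  - assert (Fpsi t x < Fpsi t v) by (apply Fpsi_increasing; auto; lra). lra.
Qed.

Lemma Fpsi_window (t x : R) : small t -> a < x < b -> F a < Fpsi t x < F b.
Proof.
  intros Ht Hx. pose proof window_order. assert (Hw := psi_window t x Ht Hx).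
  split; apply (fixed_increasing _ _ _ _ _ _ D); lra.
Qed.

Lemma disp_left (t x : R) :
  x <= p -> disp t x = t * bump a b x /\ disp1 t x = t * bump1 a b x /\ disp2 t x = t * bump2 a b x.
Proof. intros Hx. unfold disp, disp1, disp2. now rewrite !on_p1_out by auto. Qed.

(** On [(p, 1)] off the second window the preimage avoids [(a, b)], where [psi t] is the identity,
    so [F] and the inverse of [Fpsi t] cancel. *)
Lemma disp_outside (t x : R) : small t -> ~ in_window x ->
  disp t x = 0 /\ disp1 t x = 0 /\ disp2 t x = 0.
Proof.
  intros Ht Hx. unfold in_window in Hx. pose proof window_order.
  destruct (classic (p < x < 1)) as [Hp|Hp].
  - unfold disp, disp1, disp2. rewrite !on_p1_in by auto.
    destruct (Fpsi_inv_spec t x Ht Hp) as [Hv Ev].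
    set (v := Fpsi_inv t x) in *.
    assert (Hab : ~ (a < v < b)).
    { intros Hv'. apply Hx. right. rewrite <- Ev. now apply Fpsi_window. }
    destruct (psi_outside t v) as (E & E1 & E2); [lra|].
    assert (0 < F1 v) by (apply (fp_pos _ _ _ _ _ _ D); lra).
    unfold Fpsi, Fpsi1, Fpsi2 in *. cbv zeta. rewrite E, E1, E2 in *. rewrite Ev.
    repeat split; field; lra.
  - unfold disp, disp1, disp2. rewrite !on_p1_out by lra.
    destruct (bump_outside x) as (-> & -> & ->); [lra|]. repeat split; ring.
Qed.

Lemma disp_first (t x : R) : a < x < b -> x + disp t x = psi t x.
Proof.
  intros Hx. pose proof window_order. destruct (disp_left t x) as (-> & _); [lra|].
  reflexivity.
Qed.

Lemma disp_second (t x : R) :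
  small t -> a < x < b -> Fpsi t x + disp t (Fpsi t x) = F x.
Proof.
  intros Ht Hx. pose proof window_order. pose proof (Fpsi_window t x Ht Hx).
  unfold disp. rewrite on_p1_in by lra. rewrite Fpsi_inv_unique by (auto; lra). ring.
Qed.

Lemma second_window_inv (t y : R) :
  small t -> F a < y < F b -> exists x, a < x < b /\ Fpsi t x = y.
Proof.
  intros Ht Hy. pose proof window_order.
  destruct (Fpsi_inv_spec t y Ht) as [Hv Ev]; [lra|].
  exists (Fpsi_inv t y). split; auto. set (v := Fpsi_inv t y) in *.
  apply NNPP. intros Hv'. destruct (psi_outside t v) as (E & _); [lra|].
  unfold Fpsi in Ev. rewrite E in Ev. apply Hv'.
  split; apply Rnot_le_lt; intros [Hle|Hle].
  - assert (F v < F a) by (apply (fixed_increasing _ _ _ _ _ _ D); lra). lra.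
  - rewrite Hle in Ev. lra.
  - assert (F b < F v) by (apply (fixed_increasing _ _ _ _ _ _ D); lra). lra.
  - rewrite <- Hle in Ev. lra.
Qed.

Lemma disp_preserves_windows (t x : R) : small t ->
  (a < x < b -> a < x + disp t x < b) /\ (F a < x < F b -> F a < x + disp t x < F b).
Proof.
  intros Ht. pose proof window_order. split; intros Hx.
  - rewrite disp_first by auto. now apply psi_window.
  - destruct (second_window_inv t x Ht Hx) as (v & Hv & <-).
    rewrite disp_second by auto.
    split; apply (fixed_increasing _ _ _ _ _ _ D); lra.
Qed.

(** Two charts: the bump formula off [[F a, F b]] and the inverse formula on [(p, 1)]. On their
    overlap both vanish, so nothing has to be matched at an edge. *)
Lemma disp_C2 (t x : R) : small t -> C2_at (disp t) (disp1 t) (disp2 t) x.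
Proof.
  intros Ht. pose proof window_order.
  assert (Bump : C2_at (fun y => t * bump a b y) (fun y => t * bump1 a b y)
            (fun y => t * bump2 a b y) x) by apply C2_at_scal, bump_C2.
  assert (Off : forall y, ~ in_window y -> b <= y ->
    t * bump a b y = disp t y /\ t * bump1 a b y = disp1 t y /\ t * bump2 a b y = disp2 t y).
  { intros y Hy Hby. destruct (disp_outside t y Ht Hy) as (-> & -> & ->).
    destruct (bump_outside y) as (-> & -> & ->); auto. repeat split; ring. }
  destruct (Rlt_dec x (F a)) as [HxF|HxF]; [|destruct (Rlt_dec (F b) x) as [HxF'|HxF']].
  - revert Bump. apply C2_at_ext_loc.
    apply (locally_open (fun y => y < F a)); auto using open_lt.
    intros y Hy. destruct (Rle_dec y p) as [Hp|Hp].
    + now destruct (disp_left t y Hp) as (-> & -> & ->).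
    + apply Off; unfold in_window; lra.
  - revert Bump. apply C2_at_ext_loc.
    apply (locally_open (fun y => F b < y)); auto using open_gt.
    intros y Hy. apply Off; unfold in_window; lra.
  - destruct (Fpsi_ends t) as [E0 Ec].
    assert (Inv : C2_at (Fpsi_inv t) (fun z => / Fpsi1 t (Fpsi_inv t z))
        (fun z => - Fpsi2 t (Fpsi_inv t z) / Fpsi1 t (Fpsi_inv t z) ^ 3) x).
    { apply (inverse_C2 (Fpsi t) _ _ _ 0 c); try lra.
      - apply Fpsi_C2.
      - intros z Hz. now apply Fpsi1_pos.
      - rewrite E0, Ec. intros y Hy. now apply Fpsi_inv_spec. }
    generalize (C2_at_minus _ _ _ _ _ _ x
      (C2_at_comp F F1 F2 _ _ _ x (fp_C2 _ _ _ _ _ _ D _) Inv) (C2_at_id x)).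
    apply C2_at_ext_loc.
    apply (locally_open (fun y => p < y < 1)).
    + apply open_and; [apply open_gt | apply open_lt].
    + intros y Hy. unfold disp, disp1, disp2. rewrite !on_p1_in by auto.
      repeat split. cbv zeta. ring.
    + lra.
Qed.

(** Points of the second window are written [Fpsi t z] with [z] in [[a, b]]. The displacement then
    becomes [F z - F (psi t z)], jointly continuous in [t] and [z], so continuity of the inverse in
    [t] is never invoked. *)
Lemma disp_small (eps : R) : 0 < eps -> exists tau, 0 < tau /\
  forall t x, small t -> t <= tau ->
    Rabs (disp t x) <= eps /\ Rabs (disp1 t x) <= eps /\ Rabs (disp2 t x) <= eps.
Proof.
  intros He. pose proof window_order as Ord.
  assert (Cid1 : forall t z, continuity_2d_pt (fun t _ => t) t z) by apply continuity_2d_pt_id1.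
  assert (Cz : forall (f : R -> R), (forall z, continuity_pt f z) ->
    forall t z, continuity_2d_pt (fun _ z => f z) t z).
  { intros f Hf t z. apply (continuity_1d_2d_pt_comp f (fun _ z => z)); auto.
    apply continuity_2d_pt_id2. }
  assert (Cb : forall t z, continuity_2d_pt psi t z).
  { intros t z. apply continuity_2d_pt_plus; [apply continuity_2d_pt_id2|].
    apply continuity_2d_pt_mult; auto. apply Cz. intros w.
    apply (C2_at_continuity _ _ _ _ (bump_C2 a b w)). }
  assert (Cb1 : forall t z, continuity_2d_pt psi1 t z).
  { intros t z. apply continuity_2d_pt_plus; [apply continuity_2d_pt_const|].
    apply continuity_2d_pt_mult; auto. apply Cz. intros w.
    apply (C2_at_continuity _ _ _ _ (bump_C2 a b w)). }
  assert (Cb2 : forall t z, continuity_2d_pt psi2 t z).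
  { intros t z. apply continuity_2d_pt_mult; auto. apply Cz. intros w.
    apply (C2_at_continuity _ _ _ _ (bump_C2 a b w)). }
  assert (CF : forall z, continuity_pt F z).
  { intros z. apply (C2_at_continuity _ _ _ _ (fp_C2 _ _ _ _ _ _ D z)). }
  assert (CF1 : forall z, continuity_pt F1 z).
  { intros z. apply (C2_at_continuity _ _ _ _ (fp_C2 _ _ _ _ _ _ D z)). }
  assert (CF2 : forall z, continuity_pt F2 z) 
    by (intros z; apply (C2_at_continuity _ _ _ _ (fp_C2 _ _ _ _ _ _ D z))).
  assert (Cg1 : forall t z, continuity_2d_pt Fpsi1 t z).
  { intros t z. apply continuity_2d_pt_mult; auto.
    apply (continuity_1d_2d_pt_comp F1 psi); auto. }
  assert (Cg2 : forall t z, continuity_2d_pt Fpsi2 t z).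
  { intros t z. apply continuity_2d_pt_plus; apply continuity_2d_pt_mult; auto.
    - apply (continuity_1d_2d_pt_comp F2 psi); auto.
    - apply (continuity_1d_2d_pt_comp (fun v => v ^ 2) psi1); auto.
      apply derivable_continuous_pt, derivable_pt_pow.
    - apply (continuity_1d_2d_pt_comp F1 psi); auto. }
  assert (Nz : forall t z, 0 <= t <= / 24 -> a <= z <= b -> 0 < Fpsi1 t z).
  { intros t z Ht Hz. apply Fpsi1_pos; auto. lra. }
  assert (Psi0 : forall z, psi 0 z = z /\ psi1 0 z = 1 /\ psi2 0 z = 0).
  { intros z. unfold psi, psi1, psi2. repeat split; ring. }
  assert (P1 : forall z, a <= z <= b -> 0 < F1 z).
  { intros z Hz. apply (fp_pos _ _ _ _ _ _ D). lra. }
  destruct (uniform_limit_at_0 (fun t z => F z - F (psi t z)) (/ 24) a b) with (eps := eps)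
    as (tau0 & T0 & H0); auto; try lra.
  { intros t z _ _. apply continuity_2d_pt_minus; auto.
    apply (continuity_1d_2d_pt_comp F psi); auto. }
  { intros z _. destruct (Psi0 z) as (-> & _). ring. }
  destruct (uniform_limit_at_0 (fun t z => F1 z * / Fpsi1 t z - 1) (/ 24) a b) with (eps := eps)
    as (tau1 & T1 & H1); auto; try lra.
  { intros t z Ht Hz. specialize (Nz t z Ht Hz).
    apply continuity_2d_pt_minus; [|apply continuity_2d_pt_const].
    apply continuity_2d_pt_mult; auto. apply continuity_2d_pt_inv; auto. lra. }
  { intros z Hz. unfold Fpsi1. destruct (Psi0 z) as (-> & -> & _).
    specialize (P1 z Hz). field. lra. }
  destruct (uniform_limit_at_0 (fun t z => F2 z * (/ Fpsi1 t z) ^ 2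
      + F1 z * (- Fpsi2 t z / Fpsi1 t z ^ 3)) (/ 24) a b) with (eps := eps)
    as (tau2 & T2 & H2); auto; try lra.
  { intros t z Ht Hz. specialize (Nz t z Ht Hz).
    apply continuity_2d_pt_plus; apply continuity_2d_pt_mult; auto.
    - apply (continuity_1d_2d_pt_comp (fun v => v ^ 2) (fun t z => / Fpsi1 t z)).
      + apply derivable_continuous_pt, derivable_pt_pow.
      + apply continuity_2d_pt_inv; auto. lra.
    - apply continuity_2d_pt_mult; [now apply continuity_2d_pt_opp|].
      apply continuity_2d_pt_inv.
      + apply (continuity_1d_2d_pt_comp (fun v => v ^ 3) Fpsi1); auto.
        apply derivable_continuous_pt, derivable_pt_pow.
      + apply pow_nonzero. lra. }
  { intros z Hz. unfold Fpsi1, Fpsi2. destruct (Psi0 z) as (-> & -> & ->).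
    specialize (P1 z Hz). field. lra. }
  exists (Rmin (eps / 12) (Rmin tau0 (Rmin tau1 tau2))).
  split; [repeat apply Rmin_glb_lt; lra|]. intros t x Ht Htau.
  assert (t <= eps / 12 /\ t <= tau0 /\ t <= tau1 /\ t <= tau2).
  { revert Htau. unfold Rmin. repeat destruct Rle_dec; lra. }
  destruct (classic (in_window x)) as [[Hx|Hx]|Hx].
  - destruct (disp_left t x) as (-> & -> & ->); [lra|].
    destruct (bump_abs x) as (B0 & B1 & B2). unfold small in Ht.
    rewrite !Rabs_mult, (Rabs_pos_eq t) by lra. repeat split; nra.
  - destruct (second_window_inv t x Ht Hx) as (v & Hv & <-).
    pose proof (Fpsi_window t v Ht Hv).
    unfold disp, disp1, disp2. rewrite !on_p1_in by lra.
    rewrite Fpsi_inv_unique by (auto; lra). unfold small in Ht. cbv zeta.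
    repeat split; [apply H0 | apply H1 | apply H2]; lra.
  - destruct (disp_outside t x Ht Hx) as (-> & -> & ->). rewrite Rabs_R0. lra.
Qed.

(** * Copies at all scales *)

(** The [k]-th iterate of [h], affine of slope [- s], written about its fixed point [c]. *)
Definition zoom (k : nat) (y : R) : R := c + (- s) ^ k * (y - c).
Definition unzoom (k : nat) (x : R) : R := c + (x - c) / (- s) ^ k.

Lemma scale_nonzero (k : nat) : (- s) ^ k <> 0.
Proof. apply pow_nonzero. pose proof window_order. lra. Qed.

Lemma scale_abs (k : nat) : 0 < Rabs ((- s) ^ k) <= 1.
Proof.
  split; [apply Rabs_pos_lt, scale_nonzero|].
  pose proof window_order. rewrite <- RPow_abs, Rabs_Ropp, Rabs_pos_eq by lra.
  rewrite <- (pow1 k). apply pow_incr. lra.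
Qed.

Lemma zoom_unzoom (k : nat) (x : R) : zoom k (unzoom k x) = x.
Proof. unfold zoom, unzoom. pose proof (scale_nonzero k). field. auto. Qed.

Lemma unzoom_zoom (k : nat) (x : R) : unzoom k (zoom k x) = x.
Proof. unfold zoom, unzoom. pose proof (scale_nonzero k). field. auto. Qed.

Lemma zoom_S (k : nat) (y : R) : zoom (S k) y = s * (1 - zoom k y).
Proof.
  pose proof (fp_center _ _ _ _ _ _ D) as E. unfold zoom. simpl.
  replace (s * (1 - (c + (- s) ^ k * (y - c))))
    with (s * (1 - c) + - s * (- s) ^ k * (y - c)) by ring.
  now rewrite <- E.
Qed.

Lemma zoom_add (k l : nat) (y : R) : zoom (k + l) y = zoom k (zoom l y).
Proof. unfold zoom. rewrite pow_add. ring. Qed.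

Lemma zoom_injective (k : nat) (y z : R) : zoom k y = zoom k z -> y = z.
Proof. intros E. now rewrite <- (unzoom_zoom k y), E, unzoom_zoom. Qed.

Lemma zoom_I01 (k : nat) (y : R) : I01 y -> I01 (zoom k y).
Proof.
  intros Hy. pose proof window_order. induction k as [|k IH].
  - unfold zoom. simpl. replace (c + 1 * (y - c)) with y by ring. auto.
  - rewrite zoom_S. unfold I01 in *. nra.
Qed.

Lemma zoom_S_range (k : nat) (y : R) : I01 y -> 0 <= zoom (S k) y <= s.
Proof.
  intros Hy. pose proof window_order. rewrite zoom_S.
  pose proof (zoom_I01 k y Hy). unfold I01 in *. nra.
Qed.

Lemma in_window_I01 (y : R) : in_window y -> 0 < y < 1.
Proof. pose proof window_order. unfold in_window. lra. Qed.

(** A common point would lie in [[0, s]], hence in [(a, b)], and [h] would pull it back into the gap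
    [(s, p)]; the gap contains no window point, and copies of positive level stay in [[0, s]]. *)
Lemma windows_disjoint (m : nat) (y z : R) :
  in_window y -> in_window z -> y <> zoom (S m) z.
Proof.
  intros Hy Hz E. pose proof window_order.
  assert (Iz : I01 z) by (pose proof (in_window_I01 z Hz); unfold I01; lra).
  pose proof (zoom_S_range m z Iz). rewrite <- E in *. rewrite zoom_S in E.
  unfold in_window in *. assert (a < y < b) by lra.
  destruct W as [Wa _ _ Wb _].
  assert (Hw : s < zoom m z < p) by (split; apply Rnot_le_lt; intros Hle; nra).
  destruct m as [|m].
  - replace (zoom 0 z) with z in * by (unfold zoom; simpl; ring). lra.
  - pose proof (zoom_S_range m z Iz). lra.
Qed.

Lemma level_unique (k l : nat) (y z : R) :
  in_window y -> in_window z -> zoom k y = zoom l z -> k = l.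
Proof.
  assert (Lt : forall k l y z, in_window y -> in_window z ->
    zoom k y = zoom l z -> ~ (k < l)%nat).
  { intros k' l' y' z' Hy Hz E Hlt.
    replace l' with (k' + S (l' - S k'))%nat in E by lia. rewrite zoom_add in E.
    apply zoom_injective in E. now apply windows_disjoint in E. }
  intros Hy Hz E. assert (H1 := Lt _ _ _ _ Hy Hz E).
  assert (H2 := Lt _ _ _ _ Hz Hy (eq_sym E)). lia.
Qed.

(** Arbitrary at points that lie in no copy; every [piece] vanishes there, so the choice is
    harmless. *)
Definition level (x : R) : nat :=
  epsilon (inhabits 0%nat) (fun k => in_window (unzoom k x)).

Lemma level_zoom (k : nat) (y : R) : in_window y -> level (zoom k y) = k.
Proof.
  intros Hy.
  assert (Hl : in_window (unzoom (level (zoom k y)) (zoom k y))).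
  { apply (epsilon_spec (inhabits 0%nat) (fun l => in_window (unzoom l (zoom k y)))).
    exists k. now rewrite unzoom_zoom. }
  apply (level_unique _ _ _ y Hl Hy). apply zoom_unzoom.
Qed.

Lemma level_other (x : R) (k : nat) : k <> level x -> ~ in_window (unzoom k x).
Proof.
  intros Hk Hw. apply Hk. rewrite <- (zoom_unzoom k x).
  symmetry. now apply level_zoom.
Qed.

Lemma level_cases (x : R) :
  (exists y, in_window y /\ x = zoom (level x) y) \/ (forall k, ~ in_window (unzoom k x)).
Proof.
  destruct (classic (in_window (unzoom (level x) x))) as [Hw|Hw].
  - left. exists (unzoom (level x) x). split; auto. now rewrite zoom_unzoom.
  - right. intros k. destruct (Nat.eq_dec k (level x)) as [->|Hk]; auto.
    now apply level_other.
Qed.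

Definition piece_map (t : R) (k : nat) (x : R) : R :=
  x + (- s) ^ k * disp t (unzoom k x).
(** The perturbed map is written additively, as [F] plus one difference per level, to fit
    [disjoint_sum_C2]. *)
Definition piece (t : R) (k : nat) (x : R) : R := F (piece_map t k x) - F x.
Definition piece1 (t : R) (k : nat) (x : R) : R :=
  F1 (piece_map t k x) * (1 + disp1 t (unzoom k x)) - F1 x.
Definition piece2 (t : R) (k : nat) (x : R) : R :=
  F2 (piece_map t k x) * (1 + disp1 t (unzoom k x)) ^ 2
  + F1 (piece_map t k x) * (disp2 t (unzoom k x) / (- s) ^ k) - F2 x.

Lemma piece_map_zoom (t : R) (k : nat) (y : R) :
  piece_map t k (zoom k y) = zoom k (y + disp t y).
Proof. unfold piece_map. rewrite unzoom_zoom. unfold zoom. ring. Qed.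

Lemma piece_C2 (t : R) (k : nat) (x : R) :
  small t -> C2_at (piece t k) (piece1 t k) (piece2 t k) x.
Proof.
  intros Ht. pose proof (scale_nonzero k).
  assert (HU : C2_at (unzoom k) (fun _ => / (- s) ^ k) (fun _ => 0) x).
  { generalize (C2_at_affine (/ (- s) ^ k) (c - c / (- s) ^ k) x).
    apply C2_at_ext_loc, filter_forall. intros y. unfold unzoom. repeat split.
    field. auto. }
  assert (HX := C2_at_plus _ _ _ _ _ _ x (C2_at_id x) (C2_at_scal ((- s) ^ k) _ _ _ x
    (C2_at_comp _ _ _ _ _ _ x (disp_C2 t (unzoom k x) Ht) HU))).
  generalize (C2_at_minus _ _ _ _ _ _ x
    (C2_at_comp F F1 F2 _ _ _ x (fp_C2 _ _ _ _ _ _ D _) HX) (fp_C2 _ _ _ _ _ _ D x)).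
  apply C2_at_ext_loc, filter_forall. intros y. unfold piece, piece1, piece2, piece_map.
  split; [|split]; [reflexivity| |]; field; auto.
Qed.

Lemma piece_outside (t : R) (k : nat) (x : R) :
  small t -> ~ in_window (unzoom k x) ->
  piece t k x = 0 /\ piece1 t k x = 0 /\ piece2 t k x = 0.
Proof.
  intros Ht Hx. unfold piece, piece1, piece2, piece_map.
  destruct (disp_outside t _ Ht Hx) as (-> & -> & ->).
  rewrite Rmult_0_r, Rplus_0_r. repeat split; unfold Rdiv; ring.
Qed.

Lemma disp_in_window (t y : R) : small t -> in_window y -> in_window (y + disp t y).
Proof.
  intros Ht [Hy|Hy]; [left | right]; now apply (disp_preserves_windows t y Ht).
Qed.

(* [disp2] enters divided by the scale, but [F1 = O(scale)] there because the
   zoom is centred at the critical point; this makes the bound uniform in [k]. *)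
Lemma piece_small (eps : R) : 0 < eps -> exists tau, 0 < tau /\
  forall t k x, small t -> t <= tau ->
    Rabs (piece t k x) <= eps /\ Rabs (piece1 t k x) <= eps /\ Rabs (piece2 t k x) <= eps.
Proof.
  intros He. pose proof window_order as Ord.
  assert (HC := fp_C2 _ _ _ _ _ _ D).
  assert (CF2 : forall z, continuity_pt F2 z)
    by (intros z; apply (C2_at_continuity _ _ _ _ (HC z))).
  destruct (continuous_bounded F1 0 1) as (M1 & HM1 & B1).
  { intros z _. apply (C2_at_continuity _ _ _ _ (HC z)). }
  destruct (continuous_bounded F2 0 1) as (M2 & HM2 & B2); auto.
  destruct (uniform_continuity_1d F2 0 1) with (eps := eps / 4) as (dl & Hdl & UC); auto; try lra.
  set (M := M1 + M2).
  (* The bound [1] absorbs the square of [disp1], [dl / 2] allows uniform continuity of [F2], and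
     the last gives [M * r <= eps / 8]. The worst total, for [piece2], is
     [eps / 4 + 3 * eps / 8 + eps / 8]. *)
  set (r := Rmin 1 (Rmin (dl / 2) (eps / (8 * M)))).
  assert (HM : 0 < M) by (unfold M; lra).
  assert (0 < eps / (8 * M)) by (apply Rdiv_lt_0_compat; lra).
  assert (Hr : 0 < r) by (unfold r; repeat apply Rmin_glb_lt; lra).
  assert (r <= 1) by apply Rmin_l.
  assert (r <= dl / 2) by (eapply Rle_trans; [apply Rmin_r | apply Rmin_l]).
  assert (Hr3 : r <= eps / (8 * M)) by (eapply Rle_trans; [apply Rmin_r | apply Rmin_r]).
  assert (HMr : M * r <= eps / 8).
  { apply (Rmult_le_compat_l M) in Hr3; [|lra].
    replace (M * (eps / (8 * M))) with (eps / 8) in Hr3 by (field; lra). auto. }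
  destruct (disp_small r Hr) as (tau & Htau & Hs).
  exists tau. split; auto. intros t k x Ht Hle.
  destruct (classic (in_window (unzoom k x))) as [Hw|Hw].
  2:{ destruct (piece_outside t k x Ht Hw) as (-> & -> & ->). rewrite Rabs_R0. lra. }
  set (y := unzoom k x) in *.
  assert (Ex : x = zoom k y) by (unfold y; now rewrite zoom_unzoom).
  assert (Hw' := disp_in_window t y Ht Hw).
  assert (Iy := in_window_I01 _ Hw). assert (Iy' := in_window_I01 _ Hw').
  destruct (Hs t y Ht Hle) as (D0 & D1 & D2).
  unfold piece, piece1, piece2. fold y.
  assert (EX : piece_map t k x = zoom k (y + disp t y)) by (rewrite Ex; apply piece_map_zoom).
  set (X := piece_map t k x) in *.
  assert (Ix : I01 x) by (rewrite Ex; apply zoom_I01; unfold I01; lra).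
  assert (IX : I01 X) by (rewrite EX; apply zoom_I01; unfold I01; lra).
  pose proof (scale_abs k) as Sk. set (q := (- s) ^ k) in *.
  assert (XxE : X - x = q * disp t y) by (unfold X, piece_map; fold y; fold q; ring).
  assert (Xx : Rabs (X - x) <= r).
  { rewrite XxE, Rabs_mult. pose proof (Rabs_pos (disp t y)). nra. }
  assert (Xc : Rabs (X - c) <= Rabs q).
  { rewrite EX. unfold zoom. fold q.
    replace (c + q * (y + disp t y - c) - c) with (q * (y + disp t y - c)) by ring.
    rewrite Rabs_mult. assert (Rabs (y + disp t y - c) <= 1) by (apply Rabs_le; lra).
    nra. }
  assert (I01seg : forall u v z, I01 u -> I01 v -> Rmin u v <= z <= Rmax u v -> 0 <= z <= 1).
  { intros u v z [? ?] [? ?]. unfold Rmin, Rmax. destruct Rle_dec; lra. }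
  assert (L0 : Rabs (F X - F x) <= M * r).
  { apply Rle_trans with (M1 * Rabs (X - x)).
    - apply (derive_bounded_lipschitz F F1); intros z Hz; [apply HC|].
      apply B1. now apply (I01seg x X).
    - unfold M. nra. }
  assert (L1 : Rabs (F1 X - F1 x) <= M * r).
  { apply Rle_trans with (M2 * Rabs (X - x)).
    - apply (derive_bounded_lipschitz F1 F2); intros z Hz; [apply HC|].
      apply B2. now apply (I01seg x X).
    - unfold M. nra. }
  assert (L2 : Rabs (F2 X - F2 x) <= eps / 4).
  { apply Rlt_le, UC; auto. lra. }
  assert (Lc : Rabs (F1 X) <= M * Rabs q).
  { rewrite <- (Rminus_0_r (F1 X)), <- (fp_deriv_c _ _ _ _ _ _ D).
    apply Rle_trans with (M2 * Rabs (X - c)).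
    - apply (derive_bounded_lipschitz F1 F2); intros z Hz; [apply HC|].
      apply B2. apply (I01seg c X); auto. unfold I01; lra.
    - unfold M. nra. }
  assert (Q1 : Rabs (F1 X * disp1 t y) <= M * r).
  { rewrite Rabs_mult. pose proof (Rabs_pos (F1 X)). pose proof (Rabs_pos (disp1 t y)).
    specialize (B1 X IX). unfold M. nra. }
  assert (Q2 : Rabs (F2 X * (2 * disp1 t y + disp1 t y ^ 2)) <= 3 * (M * r)).
  { rewrite Rabs_mult.
    assert (Rabs (2 * disp1 t y + disp1 t y ^ 2) <= 3 * r).
    { apply Rabs_le_between in D1. apply Rabs_le. nra. }
    pose proof (Rabs_pos (F2 X)). specialize (B2 X IX).
    pose proof (Rabs_pos (2 * disp1 t y + disp1 t y ^ 2)).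
    apply Rle_trans with (M2 * (3 * r)); [|unfold M; nra].
    apply Rmult_le_compat; auto. }
  assert (Q3 : Rabs (F1 X * (disp2 t y / q)) <= M * r).
  { unfold Rdiv. rewrite !Rabs_mult, Rabs_inv.
    apply Rle_trans with (M * Rabs q * (Rabs (disp2 t y) * / Rabs q)).
    - apply Rmult_le_compat_r; auto.
      apply Rmult_le_pos; [apply Rabs_pos|]. apply Rlt_le, Rinv_0_lt_compat. lra.
    - replace (M * Rabs q * (Rabs (disp2 t y) * / Rabs q)) with (M * Rabs (disp2 t y))
        by (field; lra). nra. }
  split; [lra|split].
  - replace (F1 X * (1 + disp1 t y) - F1 x) with (F1 X - F1 x + F1 X * disp1 t y) by ring.
    pose proof (Rabs_triang (F1 X - F1 x) (F1 X * disp1 t y)). lra.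
  - replace (F2 X * (1 + disp1 t y) ^ 2 + F1 X * (disp2 t y / q) - F2 x)
      with (F2 X - F2 x + F2 X * (2 * disp1 t y + disp1 t y ^ 2) + F1 X * (disp2 t y / q))
      by ring.
    pose proof (Rabs_triang (F2 X - F2 x + F2 X * (2 * disp1 t y + disp1 t y ^ 2))
      (F1 X * (disp2 t y / q))).
    pose proof (Rabs_triang (F2 X - F2 x) (F2 X * (2 * disp1 t y + disp1 t y ^ 2))). lra.
Qed.

(** * The perturbed maps *)

Definition admissible (T : nat -> R) : Prop :=
  (forall n, small (T n)) /\
  (forall eps, 0 < eps -> exists N, forall n, (N <= n)%nat -> T n <= eps).

Definition pert_map (T : nat -> R) (x : R) : R := piece_map (T (level x)) (level x) x.
Definition pert (T : nat -> R) (x : R) : R := F (pert_map T x).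
Definition pert1 (T : nat -> R) (x : R) : R := F1 x + piece1 (T (level x)) (level x) x.
Definition pert2 (T : nat -> R) (x : R) : R := F2 x + piece2 (T (level x)) (level x) x.

Lemma pert_piece (T : nat -> R) (x : R) :
  pert T x = F x + piece (T (level x)) (level x) x.
Proof. unfold pert, pert_map, piece. ring. Qed.

Lemma piece_sum_C2 (T : nat -> R) (x : R) : admissible T ->
  C2_at (fun y => piece (T (level y)) (level y) y) (fun y => piece1 (T (level y)) (level y) y)
    (fun y => piece2 (T (level y)) (level y) y) x.
Proof.
  intros [Hs Hl].
  apply (disjoint_sum_C2 (fun k => piece (T k) k) (fun k => piece1 (T k) k)
    (fun k => piece2 (T k) k) level).
  - intros k y. now apply piece_C2.
  - intros y k Hk. apply piece_outside; auto. now apply level_other.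
  - intros e He. destruct (piece_small e He) as (tau & Htau & Hp).
    destruct (Hl tau Htau) as (N & HN). exists N. auto.
Qed.

Lemma pert_C2 (T : nat -> R) (x : R) :
  admissible T -> C2_at (pert T) (pert1 T) (pert2 T) x.
Proof.
  intros HT.
  generalize (C2_at_plus _ _ _ _ _ _ x (fp_C2 _ _ _ _ _ _ D x) (piece_sum_C2 T x HT)).
  apply C2_at_ext_loc, filter_forall. intros y. now rewrite pert_piece.
Qed.

(** [tau] does not depend on [T], so it serves all shifts of one sequence and yields [C^2]
    convergence of the renormalizations. *)
Lemma pert_close (eps : R) : 0 < eps -> exists tau, 0 < tau /\
  forall T x, (forall n, small (T n)) -> (forall n, T n <= tau) ->
    Rabs (pert T x - F x) <= eps /\ Rabs (pert1 T x - F1 x) <= eps /\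
    Rabs (pert2 T x - F2 x) <= eps.
Proof.
  intros He. destruct (piece_small eps He) as (tau & Htau & Hp).
  exists tau. split; auto. intros T x Hs Hl. rewrite pert_piece. unfold pert1, pert2.
  replace (F x + piece (T (level x)) (level x) x - F x)
    with (piece (T (level x)) (level x) x) by ring.
  replace (F1 x + piece1 (T (level x)) (level x) x - F1 x)
    with (piece1 (T (level x)) (level x) x) by ring.
  replace (F2 x + piece2 (T (level x)) (level x) x - F2 x)
    with (piece2 (T (level x)) (level x) x) by ring.
  auto.
Qed.

Lemma pert_map_zoom (T : nat -> R) (k : nat) (y : R) :
  in_window y -> pert_map T (zoom k y) = zoom k (y + disp (T k) y).
Proof. intros Hy. unfold pert_map. rewrite level_zoom by auto. apply piece_map_zoom. Qed.

Lemma zoom_0 (y : R) : zoom 0 y = y.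
Proof. unfold zoom. simpl. ring. Qed.

Lemma pert_map_window (T : nat -> R) (y : R) :
  in_window y -> pert_map T y = y + disp (T 0%nat) y.
Proof. intros Hy. rewrite <- (zoom_0 y) at 1. rewrite pert_map_zoom by auto. apply zoom_0. Qed.

Definition outside_windows (x : R) : Prop := forall k, ~ in_window (unzoom k x).

Lemma outside_windows_zoom (x : R) :
  (forall k y, in_window y -> x <> zoom k y) -> outside_windows x.
Proof. intros H k Hw. apply (H k _ Hw). now rewrite zoom_unzoom. Qed.

Lemma pert_map_outside (T : nat -> R) (x : R) :
  (forall n, small (T n)) -> outside_windows x -> pert_map T x = x.
Proof.
  intros Hs Hx. unfold pert_map, piece_map.
  destruct (disp_outside (T (level x)) (unzoom (level x) x)) as (-> & _); auto. ring.
Qed.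

Lemma window_I01 (y : R) : in_window y -> I01 y.
Proof. intros Hy. pose proof (in_window_I01 y Hy). unfold I01. lra. Qed.

Lemma outside_windows_right (x : R) : s < x -> ~ in_window x -> outside_windows x.
Proof.
  intros Hx Hn. apply outside_windows_zoom. intros [|k] y Hy E.
  - rewrite zoom_0 in E. now subst.
  - pose proof (zoom_S_range k y (window_I01 y Hy)). lra.
Qed.

Lemma outside_windows_1 : outside_windows 1.
Proof.
  pose proof window_order. apply outside_windows_right; [lra|]. unfold in_window. lra.
Qed.

Lemma outside_windows_p : outside_windows p.
Proof.
  pose proof window_order. apply outside_windows_right; [lra|]. unfold in_window. lra.
Qed.

Lemma outside_windows_0 : outside_windows 0.
Proof.
  pose proof window_order. apply outside_windows_zoom. intros [|k] y Hy E.
  - rewrite zoom_0 in E. subst. unfold in_window in Hy. lra.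
  (* Only [1] is sent to [0] by [h], so [1] would lie in a copy one level lower. *)
  - rewrite zoom_S in E. assert (E' : zoom k y = 1) by nra.
    apply (outside_windows_1 k). now rewrite <- E', unzoom_zoom.
Qed.

Lemma outside_windows_c : outside_windows c.
Proof.
  pose proof window_order. intros k. unfold unzoom, Rdiv.
  rewrite Rminus_diag, Rmult_0_l, Rplus_0_r. unfold in_window. lra.
Qed.

Lemma pert_map_cases (T : nat -> R) (x : R) : (forall n, small (T n)) ->
  (exists k y, in_window y /\ x = zoom k y /\ in_window (y + disp (T k) y) /\
     pert_map T x = zoom k (y + disp (T k) y)) \/
  (outside_windows x /\ pert_map T x = x).
Proof.
  intros Hs. destruct (level_cases x) as [(y & Hy & E)|Hx].
  - left. exists (level x), y. repeat split; auto.
    + now apply disp_in_window.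
    + rewrite E at 1. now apply pert_map_zoom.
  - right. split; auto. now apply pert_map_outside.
Qed.

Lemma pert_map_I01 (T : nat -> R) (x : R) :
  (forall n, small (T n)) -> I01 x -> I01 (pert_map T x).
Proof.
  intros Hs Hx. destruct (pert_map_cases T x Hs) as [(k & y & Hy & _ & Hy' & ->)|(_ & ->)]; auto.
  now apply zoom_I01, window_I01.
Qed.

Lemma pert_map_left (T : nat -> R) (x : R) :
  (forall n, small (T n)) -> 0 <= x <= s -> 0 <= pert_map T x <= s.
Proof.
  intros Hs Hx. pose proof window_order.
  destruct (pert_map_cases T x Hs) as [(k & y & Hy & E & Hy' & ->)|(_ & ->)]; auto.
  destruct k as [|k].
  - rewrite zoom_0 in *. subst x.
    assert (Hab : a < y < b) by (unfold in_window in Hy; lra).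
    pose proof (proj1 (disp_preserves_windows (T 0%nat) y (Hs _)) Hab). lra.
  - now apply zoom_S_range, window_I01.
Qed.

(** Self-similarity: off [(a, b)], the displacement at [h t] is the [h]-conjugate of the one at [t]
    for the shifted sequence. The second claim is what prevents the next iterate from meeting the
    second window. *)
Lemma pert_map_zoom_S (T : nat -> R) (t : R) :
  (forall n, small (T n)) -> I01 t -> ~ a < zoom 1 t < b ->
  pert_map T (zoom 1 t) = zoom 1 (pert_map (fun k => T (S k)) t) /\
  ~ a < pert_map T (zoom 1 t) < b.
Proof.
  intros Hs It Ht. pose proof window_order. pose proof (zoom_S_range 0 t It).
  destruct (pert_map_cases (fun k => T (S k)) t) as [(k & y & Hy & E & Hy' & ->)|(Ho & ->)]; auto.
  - subst t. rewrite <- !zoom_add. simpl plus. rewrite pert_map_zoom by auto. split; auto.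
    intros Hab. now apply (windows_disjoint k (zoom (S k) (y + disp (T (S k)) y))
      (y + disp (T (S k)) y)); auto; left.
  - assert (E : pert_map T (zoom 1 t) = zoom 1 t); [|now rewrite E].
    apply pert_map_outside; auto. apply outside_windows_zoom. intros [|k] y Hy E.
    + rewrite zoom_0 in E. subst y. unfold in_window in Hy. lra.
    + change (S k) with (1 + k)%nat in E. rewrite zoom_add in E.
      apply zoom_injective in E. apply (Ho k). now rewrite E, unzoom_zoom.
Qed.

(** If [h t] is in [(a, b)], the two displacements cancel and [t] lies in no copy. Otherwise the
    first iterate carries the conjugated displacement and the second carries none: its argument is
    at least [p], and could be in [(F a, F b)] only by coming from [(a, b)]. *)
Lemma pert_renorm (T : nat -> R) (t : R) :
  (forall n, small (T n)) -> I01 t ->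
  pert T (pert T (s * (1 - t))) = s * (1 - pert (fun k => T (S k)) t).
Proof.
  intros Hs It. pose proof window_order as Ord.
  rewrite <- (zoom_0 t) at 1. rewrite <- zoom_S.
  pose proof (zoom_S_range 0 t It) as Hz. unfold pert at 2.
  assert (Fixed : forall u, I01 u -> F (F (zoom 1 u)) = s * (1 - F u)).
  { intros u Hu. rewrite zoom_S, zoom_0. now apply (fp_fixed _ _ _ _ _ _ D). }
  destruct (classic (a < zoom 1 t < b)) as [Hab|Hab].
  - assert (Hw : in_window (zoom 1 t)) by now left.
    rewrite pert_map_window, disp_first by auto.
    unfold pert at 1. change (F (psi (T 0%nat) (zoom 1 t))) with (Fpsi (T 0%nat) (zoom 1 t)).
    rewrite pert_map_window by (right; now apply Fpsi_window).
    rewrite disp_second, Fixed by auto. unfold pert. rewrite pert_map_outside; auto.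
    apply outside_windows_zoom. intros k y Hy E.
    apply (windows_disjoint k (zoom 1 t) y); auto. rewrite E, <- zoom_add. reflexivity.
  - destruct (pert_map_zoom_S T t Hs It Hab) as [E Hab'].
    pose proof (pert_map_left T _ Hs Hz) as Hz'. set (z := pert_map T (zoom 1 t)) in *.
    assert (Hv : p <= F z) by now apply (fp_image _ _ _ _ _ _ D).
    unfold pert at 1. rewrite pert_map_outside; auto.
    + rewrite E. apply Fixed. now apply pert_map_I01.
    + apply outside_windows_right; [lra|]. intros [Hw|Hw]; [lra|]. apply Hab'.
      assert (Inc := fixed_increasing _ _ _ _ _ _ D).
      assert (Dec := fixed_decreasing _ _ _ _ _ _ D).
      (* The right branch over [[c, s]] stays at or above [F s], which exceeds [F b] by [gw_Fb]. *)
      assert (Hzc : z < c).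
      { apply Rnot_le_lt. intros Hc. assert (F s <= F z); [|lra].
        destruct Hz' as [_ [Hlt|Heq]]; [|rewrite Heq; lra].
        apply Rlt_le, Dec; lra. }
      split; apply Rnot_le_lt; intros [Hle|Hle].
      * assert (F z < F a) by (apply Inc; lra). lra.
      * rewrite Hle in Hw. lra.
      * assert (F b < F z) by (apply Inc; lra). lra.
      * rewrite <- Hle in Hw. lra.
Qed.

(** The displaced position is strictly increasing in [x], so the displacement creates no critical
    point. *)
Lemma disp1_gt_m1 (t x : R) : small t -> 0 < 1 + disp1 t x.
Proof.
  intros Ht. pose proof window_order. destruct (classic (in_window x)) as [[Hx|Hx]|Hx].
  - destruct (disp_left t x) as (_ & -> & _); [lra|].
    pose proof (psi1_pos t x Ht). unfold psi1 in *. lra.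
  - unfold disp1. rewrite on_p1_in by lra.
    destruct (Fpsi_inv_spec t x Ht) as [Hv _]; [lra|].
    pose proof (Fpsi1_pos t _ Ht Hv). pose proof (fp_pos _ _ _ _ _ _ D _ Hv).
    assert (0 < F1 (Fpsi_inv t x) * / Fpsi1 t (Fpsi_inv t x)); [|lra].
    apply Rmult_lt_0_compat; auto. now apply Rinv_0_lt_compat.
  - destruct (disp_outside t x Ht Hx) as (_ & -> & _). lra.
Qed.

Lemma zoom_open (k : nat) (y : R) : 0 < y < 1 -> 0 < zoom k y < 1.
Proof.
  intros Hy. pose proof window_order. induction k as [|k IH].
  - now rewrite zoom_0.
  - rewrite zoom_S. nra.
Qed.

(** Inside a copy, [pert1] is [F1] at the displaced point times a positive factor, and that point
    stays in the copy, hence away from [c]. *)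
Lemma pert1_zero (T : nat -> R) (x : R) :
  (forall n, small (T n)) -> 0 < x < 1 -> (pert1 T x = 0 <-> x = c).
Proof.
  intros Hs Hx.
  assert (Nz : forall z, 0 < z < 1 -> z <> c -> F1 z <> 0).
  { intros z Hz Hc. destruct (Rlt_dec z c).
    - pose proof (fp_pos _ _ _ _ _ _ D z). lra.
    - pose proof (fp_neg _ _ _ _ _ _ D z). lra. }
  unfold pert1. destruct (classic (in_window (unzoom (level x) x))) as [Hw|Hw].
  - split.
    + intros E. exfalso. unfold piece1 in E.
      pose proof (disp1_gt_m1 (T (level x)) (unzoom (level x) x) (Hs _)).
      pose proof (piece_map_zoom (T (level x)) (level x) (unzoom (level x) x)) as EX.
      rewrite zoom_unzoom in EX. rewrite EX in E.
      assert (Hw' := disp_in_window (T (level x)) _ (Hs _) Hw).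
      set (y' := unzoom (level x) x + disp (T (level x)) (unzoom (level x) x)) in *.
      apply (Nz (zoom (level x) y')).
      * now apply zoom_open, in_window_I01.
      * intros Ec. apply (outside_windows_c (level x)). now rewrite <- Ec, unzoom_zoom.
      * apply (Rmult_eq_reg_r (1 + disp1 (T (level x)) (unzoom (level x) x))); lra.
    + intros ->. now apply outside_windows_c in Hw.
  - destruct (piece_outside (T (level x)) (level x) x (Hs _) Hw) as (_ & -> & _).
    rewrite Rplus_0_r. split.
    + intros E. apply NNPP. intros Hc. now apply (Nz x).
    + intros ->. apply (fp_deriv_c _ _ _ _ _ _ D).
Qed.

(** The critical orbit is untouched up to [s], so all perturbed maps are rescaled by the same
    [h]. *)
Lemma pert_fixed_values (T : nat -> R) : (forall n, small (T n)) ->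
  pert T c = 1 /\ pert T 1 = 0 /\ pert T 0 = p /\ pert T p = s.
Proof.
  intros Hs. unfold pert.
  rewrite !pert_map_outside by auto using outside_windows_c, outside_windows_1,
    outside_windows_0, outside_windows_p.
  destruct D; auto.
Qed.

(** * Slow convergence *)

Lemma pert_ext (T T' : nat -> R) : (forall k, T k = T' k) -> eq01 (pert T) (pert T').
Proof. intros E x _. unfold pert, pert_map. now rewrite E. Qed.

(** At the midpoint of [(a, b)] the displacement is proportional to [T 0], and [F1] is bounded below
    on [[a, b]]. Point and constant precede [T], so they serve all shifts. *)
Lemma pert_lower_bound : exists kappa, 0 < kappa /\
  exists x, I01 x /\ forall T, small (T 0%nat) -> kappa * T 0%nat <= Rabs (pert T x - F x).
Proof.
  pose proof window_order as Ord. set (x := (a + b) / 2).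
  assert (Hx : a < x < b) by (unfold x; lra).
  destruct (continuous_pos_below F1 a b) as (m & Hm & Hb).
  { intros z Hz. split; [apply (C2_at_continuity _ _ _ _ (fp_C2 _ _ _ _ _ _ D z))|].
    apply (fp_pos _ _ _ _ _ _ D). lra. }
  pose proof (bump_pos a b x Hx) as Hbump.
  exists (m * bump a b x). split; [now apply Rmult_lt_0_compat|].
  exists x. split; [unfold I01; lra|]. intros T HT.
  unfold pert. rewrite pert_map_window by (now left). rewrite disp_first by auto.
  pose proof (psi_window (T 0%nat) x HT Hx) as Hp.
  assert (Ed : psi (T 0%nat) x - x = T 0%nat * bump a b x) by (unfold psi; ring).
  assert (0 <= T 0%nat * bump a b x) by (unfold small in HT; nra).
  destruct (MVT_gen F x (psi (T 0%nat) x) F1) as (z & Hz & ->).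
  - intros y _. apply (fp_C2 _ _ _ _ _ _ D).
  - intros y _. apply (C2_at_continuity _ _ _ _ (fp_C2 _ _ _ _ _ _ D y)).
  - rewrite Rmin_left, Rmax_right in Hz by lra. rewrite Ed.
    assert (m <= F1 z) by (apply Hb; lra).
    rewrite Rabs_pos_eq by nra. nra.
Qed.

(** The tip condition at a named point, free of the description [crit], to be transferred between
    maps that agree on [[0, 1]]. *)
Definition has_tip (f : R -> R) (x0 : R) : Prop :=
  exists (x : nat -> R) (A : R),
    (forall n, I01 (x n) /\ x n <> x0) /\ is_lim_seq x x0 /\ 0 < A /\
    is_lim_seq (fun n => (f (x n) - f x0) / (x n - x0) ^ 2) (- A).

(* The tip of [F] survives because the perturbation is [o((x - c)^2)]. *)
Lemma pert_tip (T : nat -> R) : admissible T -> has_tip F c -> has_tip (pert T) c.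
Proof.
  intros HT (x & A & Hx & Hl & HA & Hq). exists x, A. repeat split; auto; try apply Hx.
  set (e := fun y => piece (T (level y)) (level y) y).
  set (e1 := fun y => piece1 (T (level y)) (level y) y).
  set (e2 := fun y => piece2 (T (level y)) (level y) y).
  assert (HC : forall y, C2_at e e1 e2 y) by (intros y; now apply piece_sum_C2).
  destruct (piece_outside (T (level c)) (level c) c) as (E0 & E1 & E2).
  { apply HT. } { apply outside_windows_c. }
  change (e c = 0) in E0. change (e1 c = 0) in E1. change (e2 c = 0) in E2.
  (* As [e], [e1] and [e2] vanish at [c] and [e2] is continuous there, two mean value estimates give
     [Rabs (e y) <= eps / 2 * (y - c) ^ 2] near [c]. *)
  assert (Hlim : is_lim_seq (fun n => e (x n) / (x n - c) ^ 2) 0).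
  { apply is_lim_seq_Reals. intros eps He.
    destruct (HC c) as (_ & _ & C2). destruct (C2 (eps / 2)) as (d & Hd & Hb); [lra|].
    assert (B2 : forall y, Rabs (y - c) < d -> Rabs (e2 y) <= eps / 2).
    { intros y Hy. destruct (Req_dec y c) as [->|Hn].
      - rewrite E2, Rabs_R0. lra.
      - rewrite <- (Rminus_0_r (e2 y)), <- E2. apply Rlt_le, Hb.
        split; [split; [exact I | auto]|]. exact Hy. }
    assert (Seg : forall y z, Rmin c y <= z <= Rmax c y -> Rabs (z - c) <= Rabs (y - c)).
    { intros y z. unfold Rmin, Rmax, Rabs.
      repeat destruct Rle_dec; repeat destruct Rcase_abs; lra. }
    assert (B1 : forall y, Rabs (y - c) < d -> Rabs (e1 y) <= eps / 2 * Rabs (y - c)).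
    { intros y Hy. rewrite <- (Rminus_0_r (e1 y)), <- E1.
      apply (derive_bounded_lipschitz e1 e2); intros z Hz; [apply HC|].
      apply B2. apply Rle_lt_trans with (2 := Hy). auto. }
    assert (B0 : forall y, Rabs (y - c) < d -> Rabs (e y) <= eps / 2 * Rabs (y - c) * Rabs (y - c)).
    { intros y Hy. rewrite <- (Rminus_0_r (e y)), <- E0.
      apply (derive_bounded_lipschitz e e1); intros z Hz; [apply HC|].
      pose proof (Seg y z Hz). apply Rle_trans with (eps / 2 * Rabs (z - c)).
      - apply B1. lra.
      - apply Rmult_le_compat_l; lra. }
    apply is_lim_seq_Reals in Hl. destruct (Hl d Hd) as (N & HN).
    exists N. intros n Hn. specialize (HN n Hn). unfold Rdist in *.
    specialize (B0 _ HN). destruct (Hx n) as [_ Hxn].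
    assert (Hp : 0 < Rabs (x n - c)) by (apply Rabs_pos_lt; lra).
    rewrite Rminus_0_r. unfold Rdiv. rewrite Rabs_mult, Rabs_inv, <- RPow_abs.
    apply Rle_lt_trans with (eps / 2); [|lra].
    apply (Rmult_le_reg_r (Rabs (x n - c) ^ 2)); [now apply pow_lt|].
    rewrite Rmult_assoc, Rinv_l by (apply pow_nonzero; lra). lra. }
  replace (Finite (- A)) with (Finite (- A + 0)) by (f_equal; ring).
  apply (is_lim_seq_ext (fun n => (F (x n) - F c) / (x n - c) ^ 2 + e (x n) / (x n - c) ^ 2)).
  - intros n. rewrite !pert_piece. fold (e (x n)) (e c). rewrite E0. unfold Rdiv. ring.
  - now apply is_lim_seq_plus'.
Qed.

(** * Perturbed maps in the domain of renormalization *)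

Lemma pert_I01 (T : nat -> R) (x : R) :
  (forall n, small (T n)) -> I01 x -> I01 (pert T x).
Proof. intros Hs Hx. apply (fp_I01 _ _ _ _ _ _ D). now apply pert_map_I01. Qed.

(** Here and below [g] is known on [[0, 1]] only, the case of interest being an iterated
    renormalization of a perturbed map. *)
Lemma pert_derivatives (T : nat -> R) (g : R -> R) :
  admissible T -> eq01 (pert T) g ->
  C_k 1 g /\ C_k 2 g /\ eq01 (deriv_n 1 g) (pert1 T) /\ eq01 (deriv_n 2 g) (pert2 T).
Proof.
  intros HT E. apply (C2_at_deriv (pert T)); auto; intros x _;
    destruct (pert_C2 T x HT) as (H0 & H1 & H2);
    auto using is_derive_D_in, continuity_pt_continue_in.
Qed.

Lemma pert_critical (T : nat -> R) (g : R -> R) :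
  admissible T -> eq01 (pert T) g -> forall x, critical g x <-> x = c.
Proof.
  intros HT E x. pose proof window_order.
  destruct (pert_derivatives T g HT E) as (_ & _ & E1 & _). unfold critical. split.
  - intros [Hx Hd]. apply (pert1_zero T); auto; [apply HT|].
    rewrite <- E1 by (unfold I01; lra). exact Hd.
  - intros ->. split; [lra|]. change (deriv_n 1 g c = 0). rewrite E1 by (unfold I01; lra).
    apply pert1_zero; auto; [apply HT | lra].
Qed.

Lemma pert_crit (T : nat -> R) (g : R -> R) :
  admissible T -> eq01 (pert T) g -> crit g = c.
Proof.
  intros HT E. pose proof (pert_critical T g HT E) as Hc.
  apply (@iota_unique _ R_CompleteNormedModule).
  - intros y. apply Hc.
  - now apply Hc.
Qed.

Lemma pert_orb (T : nat -> R) (g : R -> R) : admissible T -> eq01 (pert T) g ->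
  orb g 1 = 1 /\ orb g 2 = 0 /\ orb g 3 = p /\ orb g 4 = s.
Proof.
  intros HT E. pose proof window_order.
  destruct (pert_fixed_values T (proj1 HT)) as (Vc & V1 & V0 & Vp).
  assert (O1 : orb g 1 = 1).
  { change (g (crit g) = 1). rewrite (pert_crit T) by auto.
    rewrite <- E; auto. unfold I01; lra. }
  assert (O2 : orb g 2 = 0).
  { change (g (orb g 1) = 0). rewrite O1, <- E; auto. unfold I01; lra. }
  assert (O3 : orb g 3 = p).
  { change (g (orb g 2) = p). rewrite O2, <- E; auto. unfold I01; lra. }
  assert (O4 : orb g 4 = s).
  { change (g (orb g 3) = s). rewrite O3, <- E; auto. unfold I01; lra. }
  auto.
Qed.

Lemma pert_U (T : nat -> R) (g : R -> R) :
  admissible T -> has_tip F c -> eq01 (pert T) g -> U 2 g.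
Proof.
  intros HT Htip E. pose proof window_order.
  destruct (pert_derivatives T g HT E) as (HC1 & HC2 & _).
  pose proof (pert_crit T g HT E) as Ec.
  destruct (pert_fixed_values T (proj1 HT)) as (Vc & V1 & _).
  assert (I1 : I01 1) by (unfold I01; lra). assert (Ic : I01 c) by (unfold I01; lra).
  split; [|split]; auto.
  - split; [|split; [|split; [|split]]]; auto.
    + intros x Hx. rewrite <- E by auto. now apply pert_I01; [apply HT|].
    + now rewrite <- E.
    + exists c. split.
      * now apply (pert_critical T g HT E).
      * intros x Hx. symmetry. now apply (pert_critical T g HT E).
    + rewrite Ec, <- E; auto.
  - destruct (pert_tip T HT Htip) as (x & A & Hx & Hl & HA & Hq).
    exists x, A. rewrite Ec. repeat split; auto; try apply Hx.
    revert Hq. apply is_lim_seq_ext. intros n. now rewrite !E by (auto; apply Hx).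
Qed.

Lemma pert_renormalizable (T : nat -> R) (g : R -> R) :
  admissible T -> eq01 (pert T) g -> renormalizable g.
Proof.
  intros HT E. pose proof window_order.
  destruct (pert_orb T g HT E) as (O1 & O2 & O3 & O4).
  assert (Hs := proj1 HT).
  unfold renormalizable, I_0_1, I_1_1. rewrite O1, O2, O3, O4, (pert_crit T) by auto.
  split; [lra|split; [|intros x; lra]]. intros y. split.
  - intros (x & Hx & <-). assert (Ix : I01 x) by (unfold I01; lra).
    rewrite <- E by auto. split; [|now apply pert_I01].
    apply (fp_image _ _ _ _ _ _ D). now apply pert_map_left.
  - intros Hy. destruct (pert_fixed_values T Hs) as (Vc & _ & V0 & _).
    (* The branch over [[0, c]] already covers [[p, 1]]. *)
    destruct (IVT_gen (pert T) 0 c y) as (x & Hx & Ex).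
    + intros x. apply (C2_at_continuity _ _ _ _ (pert_C2 T x HT)).
    + rewrite V0, Vc, Rmin_left, Rmax_right; lra.
    + rewrite Rmin_left, Rmax_right in Hx by lra.
      exists x. split; [lra|]. rewrite <- E; auto. unfold I01; lra.
Qed.

Lemma renorm_pert (T : nat -> R) (g : R -> R) :
  admissible T -> eq01 (pert T) g -> eq01 (pert (fun k => T (S k))) (renorm g).
Proof.
  intros HT E t Ht. pose proof window_order. assert (Hs := proj1 HT).
  destruct (pert_orb T g HT E) as (_ & O2 & _ & O4).
  unfold renorm, h_inv, h. rewrite O2, O4.
  replace (s + t * (0 - s)) with (s * (1 - t)) by ring.
  assert (I01 (s * (1 - t))) by (unfold I01 in *; nra).
  rewrite <- !E; auto; [|rewrite <- E by auto; now apply pert_I01].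
  rewrite pert_renorm by auto. field. lra.
Qed.

Lemma admissible_shift (T : nat -> R) (n : nat) :
  admissible T -> admissible (fun k => T (n + k)%nat).
Proof.
  intros [Hs Hl]. split; auto. intros e He. destruct (Hl e He) as (N & HN).
  exists N. intros k Hk. apply HN. lia.
Qed.

Lemma renorm_n_pert (T : nat -> R) (n : nat) :
  admissible T -> eq01 (pert (fun k => T (n + k)%nat)) (renorm_n n (pert T)).
Proof.
  intros HT. induction n as [|n IH].
  - now intros x Hx.
  - intros x Hx. change (renorm_n (S n) (pert T)) with (renorm (renorm_n n (pert T))).
    rewrite <- (renorm_pert _ _ (admissible_shift T n HT) IH) by auto.
    apply pert_ext; auto. intros k. f_equal. lia.
Qed.

End Displacement.

(** * Distances and the contradiction *)

(** The bound [eta] makes the least upper bound finite; [real] would send an infinite one to [0] and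
    spoil the lower estimate. *)
Lemma dist_bounds (k : nat) (f g : R -> R) (eta : R) :
  (forall j x, (j <= k)%nat -> I01 x -> Rabs (deriv_n j f x - deriv_n j g x) <= eta) ->
  forall j x, (j <= k)%nat -> I01 x ->
    Rabs (deriv_n j f x - deriv_n j g x) <= dist k f g <= eta.
Proof.
  intros H j x Hj Hx. unfold dist.
  set (E := fun d => exists j x, (j <= k)%nat /\ I01 x /\
    d = Rabs (deriv_n j f x - deriv_n j g x)).
  destruct (Lub_Rbar_correct E) as [Hub Hleast].
  assert (L1 := Hub (Rabs (deriv_n j f x - deriv_n j g x))
    (ex_intro _ j (ex_intro _ x (conj Hj (conj Hx eq_refl))))).
  assert (L2 : Rbar_le (Lub_Rbar E) eta).
  { apply Hleast. intros d (i & y & Hi & Hy & ->). now apply H. }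
  destruct (Lub_Rbar E); simpl in *; tauto.
Qed.

(** [kappa] is fixed before [T], so any rate of decay can be imposed afterwards. *)
Lemma slow_convergence (f : R -> R) :
  U 2 f -> renormalizable f -> eq01 (renorm f) f ->
  exists kappa, 0 < kappa /\ forall T, admissible T ->
    exists g, U 2 g /\ infinitely_renormalizable g /\
      is_lim_seq (fun n => dist 2 (renorm_n n g) f) 0 /\
      forall n, kappa * T n <= dist 0 (renorm_n n g) f.
Proof.
  intros HU Hren Hfix.
  destruct (fixed_point_data_of f HU Hren Hfix) as (F & F1 & F2 & p & s & D & E0 & E1 & E2).
  destruct (gap_window_exists _ _ _ _ _ _ D) as (a & b & W).
  set (c := crit f) in *.
  assert (Ic : I01 c) by (pose proof (fp_order _ _ _ _ _ _ D); unfold I01; lra).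
  assert (Htip : has_tip F c).
  { destruct HU as (_ & _ & x & A & Hx & Hl & HA & Hq). exists x, A.
    repeat split; auto; try apply Hx. revert Hq. apply is_lim_seq_ext. intros n.
    fold c. rewrite !E0; auto. apply Hx. }
  set (P := pert F c p s a b).
  destruct (pert_lower_bound _ _ _ _ _ _ _ _ D W) as (kappa & Hk & x0 & Ix0 & Hlow).
  fold P in Hlow.
  exists kappa. split; auto. intros T HT. exists (P T).
  assert (Sh : forall n, admissible (fun k => T (n + k)%nat)) by (intros; now apply admissible_shift).
  assert (Rn : forall n, eq01 (P (fun k => T (n + k)%nat)) (renorm_n n (P T)))
    by (intros n; now apply (renorm_n_pert _ _ _ _ _ _ _ _ D W)).
  assert (Close : forall eps, 0 < eps -> exists tau, 0 < tau /\ forall n,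
    (forall k, T (n + k)%nat <= tau) -> forall j x, (j <= 2)%nat -> I01 x ->
      Rabs (deriv_n j (renorm_n n (P T)) x - deriv_n j f x) <= eps).
  { intros eps He.
    destruct (pert_close _ _ _ _ _ _ _ _ D W eps He) as (tau & Htau & Hc).
    exists tau. split; auto. intros n Hn j x Hj Hx.
    destruct (Hc (fun k => T (n + k)%nat) x (proj1 (Sh n)) Hn) as (B0 & B1 & B2).
    destruct (pert_derivatives _ _ _ _ _ _ _ _ D W _ _ (Sh n) (Rn n)) as (_ & _ & G1 & G2).
    assert (j = 0 \/ j = 1 \/ j = 2)%nat as [-> | [-> | ->]] by lia.
    - simpl. rewrite <- (Rn n), <- E0 by auto. exact B0.
    - rewrite G1, <- E1 by auto. exact B1.
    - rewrite G2, <- E2 by auto. exact B2. }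
  split; [|split; [|split]].
  - apply (pert_U _ _ _ _ _ _ _ _ D W T); auto. now intros x Hx.
  - intros n. split.
    + now apply (pert_U _ _ _ _ _ _ _ _ D W _ _ (Sh n)).
    + now apply (pert_renormalizable _ _ _ _ _ _ _ _ D W _ _ (Sh n)).
  - apply is_lim_seq_Reals. intros eps He.
    destruct (Close (eps / 2)) as (tau & Htau & Hc); [lra|].
    destruct (proj2 HT tau Htau) as (N & HN). exists N. intros n Hn.
    assert (B : forall j x, (j <= 2)%nat -> I01 x ->
      Rabs (deriv_n j (renorm_n n (P T)) x - deriv_n j f x) <= eps / 2).
    { apply Hc. intros k. apply HN. lia. }
    destruct (dist_bounds 2 _ _ _ B 0 c) as [L1 L2]; auto; try lia.
    pose proof (Rabs_pos (deriv_n 0 (renorm_n n (P T)) c - deriv_n 0 f c)).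
    unfold Rdist. rewrite Rminus_0_r, Rabs_pos_eq; lra.
  - intros n.
    (* Both maps take values in [[0, 1]], so [1] bounds their difference. *)
    assert (Bd : exists eta, forall j x, (j <= 0)%nat -> I01 x ->
      Rabs (deriv_n j (renorm_n n (P T)) x - deriv_n j f x) <= eta).
    { exists 1. intros j x Hj Hx. replace j with 0%nat by lia. simpl.
      rewrite <- (Rn n), <- E0 by auto.
      pose proof (fp_I01 _ _ _ _ _ _ D x Hx).
      pose proof (pert_I01 _ _ _ _ _ _ _ _ D W _ x (proj1 (Sh n)) Hx) as HP.
      fold P in HP. unfold I01 in *. apply Rabs_le. lra. }
    destruct Bd as (eta & Bd).
    destruct (dist_bounds 0 _ _ _ Bd 0 x0) as [L1 _]; auto.
    simpl in L1. rewrite <- (Rn n), <- E0 in L1 by auto.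
    specialize (Hlow (fun k => T (n + k)%nat) (proj1 (Sh n) 0%nat)). cbv beta in Hlow.
    rewrite Nat.add_0_r in Hlow. lra.
Qed.

Theorem corollary1p3 :
  forall fstar : R -> R, is_analytic_fixed_point fstar -> ~ hyperbolic fstar.
Proof.
  intros f (_ & alpha0 & Ha & Hfix) (lambda & Hlam & Hhyp).
  destruct (Hfix ((alpha0 + 1) / 2)) as [((HU & _) & Hren & Heq) _]; [lra|].
  destruct (slow_convergence f HU Hren Heq) as (kappa & Hk & Hslow).
  (* A ratio strictly between [lambda] and [1], positive even for negative [lambda]; the factor
     [/ 24] below makes the sizes [small]. *)
  set (rho := (Rmax lambda 0 + 1) / 2).
  assert (Hrho : lambda < rho /\ 0 < rho < 1 /\ Rmax lambda 0 < rho).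
  { unfold rho, Rmax. destruct Rle_dec; lra. }
  assert (Hpow : is_lim_seq (fun n => rho ^ n) 0)
    by (apply is_lim_seq_geom; rewrite Rabs_pos_eq; lra).
  assert (HT : admissible (fun n => / 24 * rho ^ n)).
  { split.
    - intros n. unfold small. assert (0 <= rho ^ n <= 1); [|lra].
      split; [apply pow_le; lra|]. rewrite <- (pow1 n). apply pow_incr. lra.
    - intros eps He. apply is_lim_seq_Reals in Hpow.
      destruct (Hpow eps He) as (N & HN). exists N. intros n Hn.
      specialize (HN n Hn). unfold Rdist in HN. rewrite Rminus_0_r in HN.
      apply Rabs_def2 in HN. pose proof (pow_le rho n). lra. }
  destruct (Hslow _ HT) as (g & Hg & Hinf & Hlim & Hlow).
  destruct (Hhyp g Hg Hinf Hlim) as (C & HC).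
  assert (HB : forall n, kappa * / 24 * rho ^ n <= C * lambda ^ n).
  { intros n. specialize (HC n). specialize (Hlow n). lra. }
  assert (HC0 : 0 < C).
  { specialize (HB 0%nat). simpl in HB. nra. }
  (* A negative [lambda] already fails at [n = 1]. Otherwise [(lambda / rho) ^ n] would stay above
     [kappa / (24 C)] while tending to [0]. *)
  destruct (Rlt_dec lambda 0) as [Hneg|Hpos].
  - specialize (HB 1%nat). simpl in HB. nra.
  - assert (Hq : is_lim_seq (fun n => (lambda / rho) ^ n) 0).
    { apply is_lim_seq_geom. rewrite Rabs_pos_eq.
      - apply (Rmult_lt_reg_r rho); [lra|]. field_simplify; lra.
      - apply Rmult_le_pos; [lra|]. apply Rlt_le, Rinv_0_lt_compat. lra. }
    apply is_lim_seq_Reals in Hq.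
    destruct (Hq (kappa * / 24 / C)) as (N & HN).
    { apply Rdiv_lt_0_compat; lra. }
    specialize (HN N (le_n N)). unfold Rdist in HN. rewrite Rminus_0_r in HN.
    apply Rabs_def2 in HN. destruct HN as [HN _]. specialize (HB N).
    unfold Rdiv in HN at 1. rewrite Rpow_mult_distr, pow_inv in HN.
    assert (Hr : 0 < rho ^ N) by (apply pow_lt; lra).
    apply (Rmult_lt_compat_r (rho ^ N * C)) in HN; [|now apply Rmult_lt_0_compat].
    replace (lambda ^ N * / rho ^ N * (rho ^ N * C)) with (C * lambda ^ N) in HN
      by (field; lra).
    replace (kappa * / 24 / C * (rho ^ N * C)) with (kappa * / 24 * rho ^ N) in HN
      by (field; lra).
    lra.
Qed.
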